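(* Let $X_1$ and $X_2$ be locally compact and $\sigma$-compact Hausdorff topological spaces, let $A^1=(a^1_N)_{N\in\mathbb{N}}$ be an increasing sequence of weights on $X_1$ and let $A^2=(a^2_n)_{n\in\mathbb{N}}$ be an increasing sequence of weights on $X_2$. Put $X=X_1\times X_2$ and let $\mathcal{A}=A^1\otimes(A^2)^{-1}=((a_{N,n})_{n\in\mathbb{N}})_{N\in\mathbb{N}}$ be the double sequence of weights on $X$ given by $a_{N,n}(x_1,x_2)=a^1_N(x_1)/a^2_n(x_2)$. Assume that the Fréchet space $C(A^1)_0(X_1)$ satisfies condition $(\Omega)$ and that the Fréchet space $C(A^2)_0(X_2)$ satisfies condition (DN). Then the space $(AC)_0(X)=\operatorname{proj}_N\operatorname{ind}_n C(a_{N,n})_0(X)$ is ultrabornological.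
   Context: A weight on a locally compact, $\sigma$-compact space $Y$ is a strictly positive continuous function on $Y$. A function $g:Y\to\mathbb{R}$ vanishes at infinity if for every $\varepsilon>0$ there is a compact $K\subseteq Y$ with $|g(x)|<\varepsilon$ for all $x\in Y\setminus K$. For a weight $a$ on $Y$, $C(a)_0(Y)=\{f\in C(Y): a|f|\text{ vanishes at infinity on }Y\}$, a Banach space with norm $\|f\|_a=\sup_{x\in Y}a(x)|f(x)|$, where $C(Y)$ is the space of all continuous scalar-valued functions on $Y$. A sequence $(a_n)_n$ of weights is increasing if $a_n\le a_{n+1}$ pointwise for all $n$. For an increasing sequence $A=(a_n)_{n}$ of weights on $Y$, $C(A)_0(Y)=\operatorname{proj}_n C(a_n)_0(Y)=\bigcap_n C(a_n)_0(Y)$ with the locally convex topology given by the norms $\|f\|_n=\sup_{x\in Y}a_n(x)|f(x)|$; it is a Fréchet space. For a double sequence $((a_{N,n})_n)_N$ of weights on $X$ with $a_{N,n+1}\le a_{N,n}\le a_{N+1,n}$, one has continuous inclusions $C(a_{N,n})_0(X)\subseteq C(a_{N,n+1})_0(X)$; $\operatorname{ind}_n C(a_{N,n})_0(X)$ is the union over $n$ with the locally convex inductive limit topology, and $(AC)_0(X)=\operatorname{proj}_N\operatorname{ind}_nC(a_{N,n})_0(X)$ is the intersection over $N$ of these LB-spaces with the projective limit topology (a PLB-space). A Fréchet space $E$ with an increasing fundamental sequence of seminorms $(\|\cdot\|_n)_n$ satisfies (DN) if $$\exists n\ \forall m\ge n,\ 0<\theta<1\ \exists k\ge m,\ C>0\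 \forall x\in E:\ \|x\|_m\le C\|x\|_k^{\theta}\|x\|_n^{1-\theta}.$$ It satisfies $(\Omega)$ if $$\forall N\ \exists M\ge N\ \forall K\ge M\ \exists D>0,\ 0<\theta<1\ \forall y\in E':\ \|y\|_M^{\star}\le D(\|y\|_K^{\star})^{\theta}(\|y\|_N^{\star})^{1-\theta},$$ where $\|y\|_n^{\star}=\sup_{\|x\|_n\le1}|y(x)|\in[0,\infty]$. Both conditions are independent of the choice of the fundamental sequence of seminorms. *)

(* Defs.v *)
From HB Require Import structures.
From mathcomp Require Import all_boot all_order all_algebra.
From mathcomp Require Import complex.
From mathcomp Require Import all_classical all_reals all_analysis.

Set Implicit Arguments.
Unset Strict Implicit.
Unset Printing Implicit Defensive.

Import Order.TTheory GRing.Theory Num.Theory.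
Import numFieldNormedType.Exports.

Local Open Scope classical_set_scope.
Local Open Scope ring_scope.

(* Correspondence with the usual notation, for scalars in the real or complex
   field [scalarField R k]:
     C0 k a     C(a)_0(Y), the Banach space of a weight a, with norm [C0_norm];
     CA0 k A    C(A)_0(Y) = proj_n C(a_n)_0(Y), the Frechet space of an
                increasing sequence, with norms [CA0_norm];
     indC0 k A  ind_n C(a_n)_0(Y), the LB-space of a decreasing sequence;
     AC0 k A    (AC)_0(Y) = proj_N ind_n C(a_{N,n})_0(Y), the PLB-space of a
                double sequence, [A N n] being a_{N,n}. *)

Section DiskNotions.
Context (K : numFieldType) (E : lmodType K).
Implicit Types U B : set E.

Definition absolutely_convex U := forall (s t : K) (x y : E),
  `|s| + `|t| <= 1 -> U x -> U y -> U (s *: x + t *: y).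

Definition absorbs U B := exists2 r : K, 0 < r &
  forall t : K, r <= `|t| -> B `<=` *:%R t @` U.

Definition absorbing U := forall x, absorbs U [set x].

End DiskNotions.

(* The locally convex topology with a prescribed base of absolutely convex
   neighbourhoods of the origin. *)
HB.factory Record Lmodule_isLocallyConvex (K : numFieldType) E
    & GRing.Lmodule K E := {
  lc_base : set_system E ;
  lc_base_neq0 : exists U, lc_base U ;
  lc_base_setI : forall U V, lc_base U -> lc_base V ->
    exists2 W, lc_base W & W `<=` U `&` V ;
  lc_base_aconvex : forall U, lc_base U -> absolutely_convex U ;
  lc_base_absorbing : forall U, lc_base U -> absorbing U ;
  lc_base_scale : forall U (r : K), 0 < r -> lc_base U ->
    exists2 V, lc_base V & forall x, V x -> U (r *: x) }.

HB.builders Context K E & Lmodule_isLocallyConvex K E.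

Definition lc_nbhs (x : E) : set_system E :=
  [set A | exists2 U, lc_base U & forall y, U y -> A (x + y)].

HB.instance Definition _ := hasNbhs.Build E lc_nbhs.

Lemma lc_base_small U x : lc_base U ->
  exists2 d : K, 0 < d & forall t, `|t| <= d -> U (t *: x).
Proof.
move=> BU; have [r r0 rU] := lc_base_absorbing BU x.
have r'0 : 0 < r^-1 by rewrite invr_gt0.
exists r^-1 => // t tr; have [->|t0] := eqVneq t 0.
  have [|z Uz _] := rU r _ x erefl; first by rewrite gtr0_norm.
  have := lc_base_aconvex BU (s := 0) (t := 0) _ Uz Uz.
  by rewrite !scale0r addr0 normr0 addr0; apply; exact: ler01.
have [|z Uz <-] := rU t^-1 _ x erefl.
  by rewrite normfV -[r]invrK lef_pV2// posrE normr_gt0.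
by rewrite scalerA divff// scale1r.
Qed.

Lemma lc_base0 U : lc_base U -> U 0.
Proof.
move=> BU; have [d d0 /(_ 0)] := lc_base_small 0 BU.
by rewrite scale0r normr0; apply; exact: ltW.
Qed.

Lemma lc_base_add U : lc_base U ->
  exists2 V, lc_base V & forall x y, V x -> V y -> U (x + y).
Proof.
move=> BU; have [V BV VU] := lc_base_scale (ltr0n K 2) BU; exists V => // x y Vx Vy.
have -> : x + y = 2^-1 *: (2 *: x) + 2^-1 *: (2 *: y).
  by rewrite !scalerA mulVf ?scale1r// pnatr_eq0.
apply: (lc_base_aconvex BU); [|exact: VU..].
by rewrite ger0_norm ?invr_ge0 ?ler0n// -[2^-1]div1r -splitr.
Qed.

Lemma lc_baseZ U s x : lc_base U -> `|s| <= 1 -> U x -> U (s *: x).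
Proof.
move=> BU s1 Ux; have := lc_base_aconvex BU (s := s) (t := 0) _ Ux Ux.
by rewrite normr0 addr0 scale0r addr0; exact.
Qed.

Lemma lc_nbhs_filter x : ProperFilter (lc_nbhs x).
Proof.
split.
  by move=> [U BU /(_ 0)]; apply; exact: lc_base0.
split.
- by have [U BU] := lc_base_neq0; exists U.
- move=> A B [U BU UA] [V BV VB]; have [W BW WUV] := lc_base_setI BU BV.
  by exists W => // y /WUV[Uy Vy]; split; [exact: UA|exact: VB].
- by move=> A B AB [U BU UA]; exists U => // y /UA /AB.
Qed.

Lemma lc_nbhs_singleton (x : E) (A : set E) : nbhs x A -> A x.
Proof. by move=> [U BU /(_ 0)]; rewrite addr0; apply; exact: lc_base0. Qed.

Lemma lc_nbhs_nbhs (x : E) (A : set E) : nbhs x A -> nbhs x (nbhs^~ A).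
Proof.
move=> [U BU UA]; have [V BV VU] := lc_base_add BU.
exists V => // y Vy; exists V => // z Vz; rewrite -addrA.
exact/UA/VU.
Qed.

HB.instance Definition _ := Nbhs_isNbhsTopological.Build E
  lc_nbhs_filter lc_nbhs_singleton lc_nbhs_nbhs.

Lemma lc_add_continuous : continuous (fun x : E * E => x.1 + x.2).
Proof.
move=> [x y] A [U BU UA]; have [V BV VU] := lc_base_add BU.
exists ([set x + z | z in V], [set y + z | z in V]).
  by split; exists V => // z Vz; exists z.
move=> [_ _] /= [[u Vu <-] [v Vv <-]].
by rewrite addrACA; apply: UA; exact: VU.
Qed.

Lemma lc_scale_continuous : continuous (fun z : K^o * E => z.1 *: z.2).
Proof.
move=> [a x] A [U BU UA]; have [V BV VU] := lc_base_add BU.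
have [d d0 dV] := lc_base_small x BV.
have r0 : 0 < `|a| + d by rewrite ltr_wpDl.
have [W BW WV] := lc_base_scale r0 BV.
exists (ball (a : K^o) d, [set x + z | z in W]).
  by split; [exact: nbhsx_ballx|exists W => // z Wz; exists z].
move=> [b _] /= [+ [v Wv <-]]; rewrite -ball_normE /= => abd.
have -> : b *: (x + v) = a *: x + ((b - a) *: x + b *: v).
  by rewrite addrA -scalerDl subrKC scalerDr.
apply/UA/VU; first by apply: dV; rewrite distrC ltW.
have -> : b *: v = (b / (`|a| + d)) *: ((`|a| + d) *: v).
  by rewrite scalerA divfK// gt_eqF.
apply: lc_baseZ => //; last exact: WV.
rewrite normf_div (gtr0_norm r0) ler_pdivrMr// mul1r.
by rewrite -[b](subrK a) addrC (le_trans (ler_normD _ _))// lerD2l distrC ltW.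
Qed.

Lemma lc_locally_convex : exists2 B : set_system E,
  (forall b, b \in B -> convex_set b) & basis B.
Proof.
exists [set b | open b /\ convex_set b]; first by move=> b /[!inE] -[].
split=> [b [] //|x A [U BU UA]].
exists (interior [set x + y | y in U]); last first.
  by move=> y /interior_subset [z Uz <-]; exact: UA.
split; last by exists U => // y Uy; exists y.
split; first exact: open_interior.
apply/convex_setW => y z; rewrite !inE => -[V BV Vy] [W BW Wz] l l0 l1.
have [T BT TVW] := lc_base_setI BV BW; rewrite inE; exists T => // v Tv.
have [/Vy[y' Uy' y'E] /Wz[z' Uz' z'E]] := TVW _ Tv.
have lE : l%:num + (1 - l%:num) = 1 by rewrite subrKC.
exists (l%:num *: y' + (1 - l%:num) *: z').
  apply: (lc_base_aconvex BU) => //.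
  by rewrite !ger0_norm ?lE// subr_ge0 ?ltW.
rewrite [conv _ _ _](_ : _ = l%:num *: y + (1 - l%:num) *: z)//.
have split1 (w : E) : w = l%:num *: w + (1 - l%:num) *: w.
  by rewrite -scalerDl lE scale1r.
rewrite [in LHS](split1 x) [in RHS](split1 v) addrACA -!scalerDr y'E z'E.
by rewrite !scalerDr addrACA.
Qed.

HB.instance Definition _ := PreTopologicalLmod_isTvs.Build K E
  lc_add_continuous lc_scale_continuous lc_locally_convex.
HB.instance Definition _ :=
  PreTopologicalNmodule_isTopologicalNmodule.Build E lc_add_continuous.
HB.instance Definition _ :=
  TopologicalNmodule_isTopologicalLmodule.Build K E lc_scale_continuous.
HB.instance Definition _ := Uniform_isTvs.Build K E lc_locally_convex.

HB.end.

Section TvsFacts.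
Context (K : numFieldType) (E : tvsType K).

Lemma nbhs0_absorbing (U : set E) : nbhs 0 U -> absorbing U.
Proof.
move=> U0 x; have := @scale_continuous K E (0, x) U.
rewrite /= scale0r => /(_ U0)[[A B] /= [A0 Bx] ABU].
have [d /= d0 dA] := (nbhs_ballP (0 : K^o) A).1 A0.
exists (2 / d); first by rewrite divr_gt0.
move=> t dt _ ->; have t0 : t != 0.
  by rewrite -normr_gt0 (lt_le_trans _ dt)// divr_gt0.
exists (t^-1 *: x); last by rewrite scalerA divff// scale1r.
apply: (ABU (t^-1, x)); split; last exact: nbhs_singleton.
apply: dA; rewrite -ball_normE /= sub0r normrN normfV.
rewrite -[d]invrK ltf_pV2 ?posrE ?invr_gt0 ?normr_gt0//.
apply: lt_le_trans dt; rewrite ltr_pMl ?invr_gt0//; exact: (ltr1n K 2).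
Qed.

Lemma nbhs0_scale (U : set E) (r : K) : 0 < r -> nbhs 0 U ->
  nbhs 0 [set x | U (r *: x)].
Proof.
move=> r0 U0; have rV0 : r^-1 != 0 by rewrite invr_eq0 gt_eqF.
apply: filterS (nbhs0Z rV0 U0) => _ [x Ux <-] /=.
by rewrite scalerA divff ?scale1r// gt_eqF.
Qed.

Lemma nbhs0_aconvex (U : set E) : nbhs 0 U ->
  exists V, [/\ nbhs 0 V, absolutely_convex V & V `<=` U].
Proof.
move=> U0; have [B Bconvex [Bopen Bbasis]] := @locally_convex K E.
have [W [BW W0] WU] := Bbasis 0 U U0.
have nW : nbhs 0 W by apply: open_nbhs_nbhs; split => //; exact: Bopen.
exists [set x | forall t : K, `|t| <= 1 -> W (t *: x)]; split.
- have := @scale_continuous K E (0, 0) W.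
  rewrite /= scale0r => /(_ nW)[[A C] /= [A0 C0] ACW].
  have [d /= d0 dA] := (nbhs_ballP (0 : K^o) A).1 A0.
  have d20 : 0 < (d / 2)^-1 by rewrite invr_gt0 divr_gt0.
  apply: filterS (nbhs0_scale d20 C0) => x /= Cx t t1.
  have -> : t *: x = (t * (d / 2)) *: ((d / 2)^-1 *: x).
    by rewrite scalerA mulfK// -invr_eq0 gt_eqF.
  apply: (ACW (_, _)); split => //; apply: dA.
  rewrite -ball_normE /= sub0r normrN normrM (@gtr0_norm _ (d / 2)) ?divr_gt0//.
  rewrite (le_lt_trans (ler_piMl _ t1)) ?divr_ge0// ?ltW//.
  by rewrite ltr_pdivrMr// ltr_pMr// (ltr1n K 2).
- move=> s t x y st Wx Wy c c1.
  have [/eqP|st0] := eqVneq (`|s| + `|t|) 0.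
    rewrite paddr_eq0// !normr_eq0 => /andP[/eqP -> /eqP ->].
    by rewrite !scale0r addr0 scaler0.
  pose m := `|s| + `|t|.
  have m0 : 0 < m by rewrite lt0r st0 addr_ge0.
  pose sx := if s == 0 then 0 else s / `|s|.
  pose ty := if t == 0 then 0 else t / `|t|.
  have sxE : s = `|s| * sx.
    rewrite /sx; case: eqVneq => [->|s0]; first by rewrite normr0 mul0r.
    by rewrite mulrCA divff ?mulr1// normr_eq0.
  have tyE : t = `|t| * ty.
    rewrite /ty; case: eqVneq => [->|s0]; first by rewrite normr0 mul0r.
    by rewrite mulrCA divff ?mulr1// normr_eq0.
  have sx1 : `|sx| <= 1.
    rewrite /sx; case: eqVneq => [_|s0]; first by rewrite normr0.
    by rewrite normf_div normr_id divff// normr_eq0.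
  have ty1 : `|ty| <= 1.
    rewrite /ty; case: eqVneq => [_|s0]; first by rewrite normr0.
    by rewrite normf_div normr_id divff// normr_eq0.
  have l0 : 0 <= `|s| / m by rewrite divr_ge0// ltW.
  have l1 : `|s| / m <= 1 by rewrite ler_pdivrMr// mul1r lerDl.
  have lE : 1 - `|s| / m = `|t| / m.
    by rewrite -[1](divff (lt0r_neq0 m0)) -mulrBl addrAC subrr add0r.
  have mW z u : (forall t : K, `|t| <= 1 -> W (t *: z)) -> `|u| <= 1 ->
      W ((c * m * u) *: z).
    move=> Wz u1; apply: Wz; rewrite !normrM mulr_ile1// mulr_ile1//.
    by rewrite gtr0_norm.
  have := Bconvex W (mem_set BW) ((c * m * sx) *: x) ((c * m * ty) *: y)
     (Itv01 l0 l1) (mem_set (mW _ _ Wx sx1)) (mem_set (mW _ _ Wy ty1)).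
  rewrite inE; congr (W _).
  rewrite [conv _ _ _](_ : _ = (`|s| / m) *: ((c * m * sx) *: x) +
    (1 - `|s| / m) *: ((c * m * ty) *: y))// lE !scalerA scalerDr !scalerA.
  have aux p u : p / m * (c * m * u) = c * (p * u).
    by rewrite -mulrA [c * m]mulrC -mulrA mulKf ?gt_eqF// mulrCA.
  by rewrite !aux -sxE -tyE.
- by move=> x /(_ 1); rewrite normr1 scale1r => /(_ (lexx _)) /WU.
Qed.

Lemma nbhs_shift0 (x : E) (A : set E) : nbhs x A <-> nbhs 0 [set y | A (x + y)].
Proof.
split=> [xA|A0].
  have := @nbhsB K E A x (- x) xA; rewrite addNr; apply: filterS => _ [y Ay <-].
  by rewrite /= addrA subrr add0r.
by apply: filterS (nbhsT x A0) => _ [y Ay <-].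
Qed.

End TvsFacts.

Lemma linear_continuous_at0 (K : numFieldType) (E F : tvsType K)
    (T : {linear E -> F}) :
  (forall U, nbhs 0 U -> nbhs 0 (T @^-1` U)) <-> continuous T.
Proof.
split=> [T0 x A /nbhs_shift0 xA|cT U]; last first.
  by move=> U0; have := cT 0 U; rewrite linear0; exact.
apply/nbhs_shift0; apply: filterS (T0 _ xA) => y /=.
by rewrite linearD.
Qed.

(* The scalar field is either the reals or the complex numbers; [scalarField R k]
   treats both at once. *)
Variant scalar_kind := RealScalars | ComplexScalars.

Definition scalarField (R : realType) (k : scalar_kind) : numFieldType :=
  match k with RealScalars => R | ComplexScalars => R[i] end.

(* The norm of a [numFieldType] takes its values in the field itself; [modulus]
   is the corresponding real number. *)
Definition modulus (R : realType) (k : scalar_kind) : scalarField R k -> R :=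
  match k with
  | RealScalars => fun x : R => `|x|
  | ComplexScalars => fun z : R[i] => complex.Re `|z|
  end.

Definition of_real (R : realType) (k : scalar_kind) : R -> scalarField R k :=
  match k with
  | RealScalars => fun r => r
  | ComplexScalars => fun r => (r%:C)%C
  end.

Section Modulus.
Context (R : realType) (k : scalar_kind).
Implicit Types x y : scalarField R k.
Local Notation of_real := (@of_real R k).

Lemma normr_modulus x : `|x| = of_real (modulus x).
Proof. by case: k x => //= x; rewrite /modulus normc_def. Qed.

Lemma le_of_real (r s : R) : (of_real r <= of_real s) = (r <= s).
Proof. by case: k => //=; rewrite lecR. Qed.

Lemma lt_of_real (r s : R) : (of_real r < of_real s) = (r < s).
Proof. by case: k => //=; rewrite ltcR. Qed.

Lemma of_realD (r s : R) : of_real (r + s) = of_real r + of_real s.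
Proof. by case: k => //=; rewrite rmorphD. Qed.

Lemma of_realM (r s : R) : of_real (r * s) = of_real r * of_real s.
Proof. by case: k => //=; rewrite rmorphM. Qed.

Lemma of_real0 : of_real 0 = 0. Proof. by case: k. Qed.

Lemma of_real1 : of_real 1 = 1. Proof. by case: k. Qed.

Lemma of_real_inj : injective of_real.
Proof. by case: k => //= r s []. Qed.

Lemma le_modulus x y : (modulus x <= modulus y) = (`|x| <= `|y|).
Proof. by rewrite !normr_modulus le_of_real. Qed.

Lemma modulus_ge0 x : 0 <= modulus x.
Proof. by rewrite -le_of_real of_real0 -normr_modulus. Qed.

Lemma modulusM x y : modulus (x * y) = modulus x * modulus y.
Proof. by apply: of_real_inj; rewrite of_realM -!normr_modulus normrM. Qed.

Lemma le_modulusD x y : modulus (x + y) <= modulus x + modulus y.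
Proof. by rewrite -le_of_real of_realD -!normr_modulus ler_normD. Qed.

Lemma modulusN x : modulus (- x) = modulus x.
Proof. by apply: of_real_inj; rewrite -!normr_modulus normrN. Qed.

Lemma modulus0 : modulus (0 : scalarField R k) = 0.
Proof. by apply: of_real_inj; rewrite -normr_modulus normr0 of_real0. Qed.

Lemma modulus1 : modulus (1 : scalarField R k) = 1.
Proof. by apply: of_real_inj; rewrite -normr_modulus normr1 of_real1. Qed.

Lemma modulus_eq0 x : (modulus x == 0) = (x == 0).
Proof.
by rewrite -(inj_eq of_real_inj) -normr_modulus of_real0 normr_eq0.
Qed.

Lemma modulus_gt0 x : (0 < modulus x) = (x != 0).
Proof. by rewrite lt0r modulus_eq0 modulus_ge0 andbT. Qed.

Lemma modulusV x : modulus x^-1 = (modulus x)^-1.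
Proof.
have [->|x0] := eqVneq x 0; first by rewrite invr0 modulus0 invr0.
have mx0 : modulus x != 0 by rewrite modulus_eq0.
by apply: (mulfI mx0); rewrite -modulusM !divff// modulus1.
Qed.

Lemma modulus_continuous : continuous (@modulus R k).
Proof.
move=> x A /nbhs_ballP[e /= e0 eA]; apply/nbhs_ballP; exists (of_real e).
  by rewrite /= -of_real0 lt_of_real.
move=> y; rewrite -ball_normE /= => xy; apply: eA; rewrite -ball_normE /=.
move: xy; rewrite normr_modulus lt_of_real; apply: le_lt_trans; rewrite ler_norml.
apply/andP; split.
  rewrite lerNl opprB lerBlDr -[modulus (x - y)]modulusN opprB.
  by rewrite (le_trans _ (le_modulusD _ _))// subrK.
by rewrite lerBlDr (le_trans _ (le_modulusD _ _))// subrK.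
Qed.

End Modulus.

Section LocallyConvexSpaces.
Context (R : realType) (k : scalar_kind).
Local Notation K := (scalarField R k).

Section Seminorms.
Context (E : tvsType K) (p : nat -> E -> R).

Definition condition_DN := exists n : nat,
  forall (m : nat) (theta : R), (n <= m)%N -> 0 < theta < 1 ->
  exists (l : nat) (C : R), [/\ (m <= l)%N, 0 < C &
    forall x : E, p m x <= C * (p l x `^ theta) * (p n x `^ (1 - theta))].

Definition dual_norm (n : nat) (y : E -> K^o) : \bar R :=
  ereal_sup [set (modulus (y x))%:E | x in [set x | p n x <= 1]].

Definition condition_Omega := forall N : nat, exists2 M : nat, (N <= M)%N &
  forall L : nat, (M <= L)%N -> exists (D theta : R), [/\ 0 < D, 0 < theta < 1 &
    forall y : {linear E -> K^o}, continuous y ->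
    (dual_norm M y <=
      D%:E * (dual_norm L y `^ theta) * (dual_norm N y `^ (1 - theta)))%E].

End Seminorms.

Section Ultrabornological.
Context (E : tvsType K).
Implicit Types (B U : set E).

Definition tvs_bounded B := forall U, nbhs 0 U -> absorbs U B.

(* The linear span of an absolutely convex set [B] is the union of its
   multiples; [gauge B] is the Minkowski functional of [B] on it. *)
Definition disk_span B : set E := [set x | exists t : K, ( *:%R t @` B) x].

Definition gauge B (x : E) : R :=
  inf [set modulus t | t in [set t : K | ( *:%R t @` B) x]].

Definition banach_disk B := [/\
  B !=set0,
  absolutely_convex B,
  tvs_bounded B,
  (forall x, disk_span B x -> gauge B x = 0 -> x = 0) &
  forall u : nat -> E, (forall n, disk_span B (u n)) ->
    (forall e : R, 0 < e -> exists N : nat, forall m n : nat,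
      (N <= m)%N -> (N <= n)%N -> gauge B (u m - u n) < e) ->
    exists2 x, disk_span B x &
      forall e : R, 0 < e -> exists N : nat, forall n : nat,
        (N <= n)%N -> gauge B (u n - x) < e].

Definition ultrabornological := forall U, absolutely_convex U ->
  (forall B, banach_disk B -> absorbs U B) -> nbhs 0 U.

End Ultrabornological.
End LocallyConvexSpaces.

Section Subspaces.
Context (K : numFieldType) (V : lmodType K).

Record lsubspace := LSubspace {
  lsubspace_set :> set V ;
  lsubspace0 : lsubspace_set 0 ;
  lsubspaceP : forall (a : K) (u v : V),
    lsubspace_set u -> lsubspace_set v -> lsubspace_set (a *: u + v) }.

Context (S : lsubspace).

Definition lsubspace_pred : {pred V} := [pred x | `[< lsubspace_set S x >]].

Lemma lsubspace_pred_closed : GRing.submod_closed lsubspace_pred.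
Proof.
split; first by apply/asboolP; exact: lsubspace0.
by move=> a u v /asboolP Su /asboolP Sv; apply/asboolP; exact: lsubspaceP.
Qed.

HB.instance Definition _ :=
  GRing.isSubmodClosed.Build K V lsubspace_pred lsubspace_pred_closed.

Record lsubspace_of := LSubspaceOf {
  lsubspace_val :> V ; lsubspace_valP : lsubspace_val \in lsubspace_pred }.

HB.instance Definition _ := [isSub for lsubspace_val].
HB.instance Definition _ := [Choice of lsubspace_of by <:].
HB.instance Definition _ := [SubChoice_isSubLmodule of lsubspace_of by <:].

Lemma lsubspace_of_set (x : lsubspace_of) : lsubspace_set S (lsubspace_val x).
Proof. by have /asboolP := lsubspace_valP x. Qed.

End Subspaces.

Section Inclusion.
Context (K : numFieldType) (V : lmodType K) (S T : lsubspace V).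
Hypothesis ST : S `<=` T.

Definition inclusion (x : lsubspace_of S) : lsubspace_of T :=
  @LSubspaceOf K V T (lsubspace_val x) (asboolT (ST (lsubspace_of_set x))).

Lemma inclusion_is_linear : linear inclusion.
Proof. by move=> a x y; apply: val_inj. Qed.

HB.instance Definition _ := GRing.isLinear.Build K (lsubspace_of S)
  (lsubspace_of T) *:%R inclusion inclusion_is_linear.

End Inclusion.

Section Weights.
Context (R : realType).

Definition sigma_compact (Y : topologicalType) := exists2 F : nat -> set Y,
  (forall n, compact (F n)) & \bigcup_n F n = [set: Y].

Definition vanishes_at_infinity (Y : topologicalType) (g : Y -> R) :=
  forall e : R, 0 < e ->
  exists2 F : set Y, compact F & forall x, ~ F x -> `|g x| < e.

Record weight (Y : topologicalType) := Weight {
  weight_fun :> Y -> R ;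
  weight_continuous : continuous weight_fun ;
  weight_gt0 : forall x, 0 < weight_fun x }.

Record increasing_weights (Y : topologicalType) := IncreasingWeights {
  iweight :> nat -> weight Y ;
  iweight_le : forall n x, iweight n x <= iweight n.+1 x }.

Record decreasing_weights (Y : topologicalType) := DecreasingWeights {
  dweight :> nat -> weight Y ;
  dweight_le : forall n x, dweight n.+1 x <= dweight n x }.

Record double_weights (Y : topologicalType) := DoubleWeights {
  double_weight :> nat -> decreasing_weights Y ;
  double_weight_le : forall N n x,
    double_weight N n x <= double_weight N.+1 n x }.

Lemma iweight_homo Y (A : increasing_weights Y) m n x : (m <= n)%N ->
  A m x <= A n x.
Proof.
by move=> mn; apply: (homo_leq (f := A ^~ x) lexx le_trans _ mn) => i;
  exact: iweight_le.
Qed.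

Lemma dweight_homo Y (A : decreasing_weights Y) m n x : (m <= n)%N ->
  A n x <= A m x.
Proof.
move=> mn; apply: (homo_leq (f := A ^~ x) (r := fun u v => v <= u) _ _ _ mn).
- by move=> y; exact: lexx.
- by move=> y z t zy ty; exact: le_trans ty zy.
- by move=> i; exact: dweight_le.
Qed.

Section TensorInverse.
Context (X1 X2 : topologicalType).
Context (A1 : increasing_weights X1) (A2 : increasing_weights X2).

Definition tensor_inv_fun (N n : nat) (x : X1 * X2) : R := A1 N x.1 / A2 n x.2.

Lemma tensor_inv_continuous N n : continuous (tensor_inv_fun N n).
Proof.
move=> x; apply: cvgM.
  by apply: (cvg_comp _ _ (cvg_fst (F := nbhs x.1) (G := nbhs x.2)));
    exact: weight_continuous.
apply: cvgV; first by rewrite gt_eqF// weight_gt0.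
by apply: (cvg_comp _ _ (cvg_snd (F := nbhs x.1) (G := nbhs x.2)));
  exact: weight_continuous.
Qed.

Lemma tensor_inv_gt0 N n x : 0 < tensor_inv_fun N n x.
Proof. by rewrite divr_gt0// weight_gt0. Qed.

Definition tensor_inv_weight N n :=
  Weight (@tensor_inv_continuous N n) (@tensor_inv_gt0 N n).

Lemma tensor_inv_decr N n x :
  tensor_inv_weight N n.+1 x <= tensor_inv_weight N n x.
Proof.
rewrite ler_pM2l ?weight_gt0// lef_pV2 ?posrE ?weight_gt0//.
exact: iweight_le.
Qed.

Lemma tensor_inv_incr N n x :
  tensor_inv_weight N n x <= tensor_inv_weight N.+1 n x.
Proof. by rewrite ler_pM2r ?invr_gt0 ?weight_gt0//; exact: iweight_le. Qed.

Definition tensor_inv : double_weights (X1 * X2)%type :=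
  @DoubleWeights _ (fun N => DecreasingWeights (@tensor_inv_decr N))
    tensor_inv_incr.

End TensorInverse.
End Weights.

Section WeightedFunctions.
Context (R : realType) (k : scalar_kind) (Y : topologicalType).
Local Notation K := (scalarField R k).
Implicit Types (a b : weight R Y) (f g : Y -> K^o).

Definition C0_set a : set (Y -> K^o) := [set f |
  continuous f /\ vanishes_at_infinity (fun x => a x * modulus (f x))].

Definition wnorm a f : R := sup (range (fun x => a x * modulus (f x))).

Lemma wmod_ge0 a f x : 0 <= a x * modulus (f x).
Proof. by rewrite mulr_ge0 ?modulus_ge0// ltW// weight_gt0. Qed.

Lemma C0_set0 a : C0_set a 0.
Proof.
split; first exact: cst_continuous.
move=> e e0; exists set0 => [|x _]; first exact: compact0.
by rewrite modulus0 mulr0 normr0.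
Qed.

Lemma C0_setP a (s : K) f g : C0_set a f -> C0_set a g -> C0_set a (s *: f + g).
Proof.
move=> [cf vf] [cg vg]; split.
  move=> x; apply: (@cvgD _ K^o); last exact: cg.
  by apply: (@cvgZl_tmp _ K^o); exact: cf.
move=> e e0; pose d := e / 2 / (modulus s + 1).
have s0 : 0 < modulus s + 1 by rewrite ltr_wpDl// modulus_ge0.
have d0 : 0 < d by rewrite !divr_gt0.
have [F Fc Ff] := vf _ d0.
have [G Gc Gg] := vg (e / 2) (divr_gt0 e0 (ltr0n R 2)).
exists (F `|` G); first exact: compactU.
move=> x /not_orP[/Ff + /Gg].
rewrite !ger0_norm ?wmod_ge0// => fx gx.
rewrite (@le_lt_trans _ _ (modulus s * (a x * modulus (f x)) +
  a x * modulus (g x)))//.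
  rewrite mulrCA -mulrDr ler_pM2l ?weight_gt0//.
  by rewrite (le_trans (le_modulusD _ _))// modulusM.
rewrite [ltRHS]splitr ler_ltD//.
rewrite (le_trans (ler_wpM2l (modulus_ge0 s) (ltW fx)))//.
rewrite /d mulrCA ler_piMr//; first by rewrite ltW// divr_gt0.
by rewrite ler_pdivrMr// mul1r lerDl.
Qed.

Lemma C0_set_le a b : (forall x, b x <= a x) -> C0_set a `<=` C0_set b.
Proof.
move=> ba f [cf vf]; split => // e e0; have [F Fc Ff] := vf _ e0.
exists F => // x /Ff; rewrite !ger0_norm ?wmod_ge0//.
by apply: le_lt_trans; rewrite ler_wpM2r ?modulus_ge0.
Qed.

Lemma C0_set_bounded a f : C0_set a f ->
  has_ubound (range (fun x => a x * modulus (f x))).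
Proof.
move=> [cf /(_ 1 ltr01)[F Fc Ff]].
have gc : {within F, continuous (fun x => a x * modulus (f x))}.
  apply: continuous_subspaceT => x; apply: cvgM; first exact: weight_continuous.
  by apply: (cvg_comp _ _ (cf x)); exact: modulus_continuous.
have [M [Mr MF]] := compact_bounded (continuous_compact gc Fc).
have {}MF x : F x -> a x * modulus (f x) <= M + 1.
  move=> Fx; have M1 : M < M + 1 by rewrite ltrDl.
  have /= := MF _ M1 (a x * modulus (f x)).
  by rewrite ger0_norm ?wmod_ge0//; apply; exists x.
exists (Num.max (M + 1) 1) => _ [x _ <-]; rewrite le_max.
have [/MF ->//|/Ff] := pselect (F x).
by rewrite ger0_norm ?wmod_ge0// => /ltW ->; rewrite orbT.
Qed.

Lemma wnorm_ub a f x : C0_set a f -> a x * modulus (f x) <= wnorm a f.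
Proof. by move=> /C0_set_bounded fb; apply: ub_le_sup => //; exists x. Qed.

Lemma wnorm_le a f (c : R) : 0 <= c -> (forall x, a x * modulus (f x) <= c) ->
  wnorm a f <= c.
Proof.
move=> c0 fc; rewrite /wnorm.
have [->|/set0P] := eqVneq (range (fun x => a x * modulus (f x))) set0.
  by rewrite sup0.
by move=> ne; apply: ge_sup => // _ [x _ <-].
Qed.

Lemma wnorm_ge0 a f : C0_set a f -> 0 <= wnorm a f.
Proof.
move=> fa; have [[x _]|Y0] := pselect (exists x : Y, True).
  exact: le_trans (wmod_ge0 a f x) (wnorm_ub x fa).
rewrite /wnorm; set A := [set _ | _ in _].
suff -> : A = set0 by rewrite sup0.
by rewrite -subset0 => z [x _ _]; apply: Y0; exists x.
Qed.

Lemma wnorm_lin a f g (s t : K) : C0_set a f -> C0_set a g ->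
  wnorm a (s *: f + t *: g) <= modulus s * wnorm a f + modulus t * wnorm a g.
Proof.
move=> fa ga; apply: wnorm_le => [|x].
  by rewrite addr_ge0// mulr_ge0 ?modulus_ge0 ?wnorm_ge0.
rewrite (@le_trans _ _ (a x * (modulus s * modulus (f x) +
    modulus t * modulus (g x))))//.
  rewrite ler_pM2l ?weight_gt0// -!modulusM; exact: le_modulusD.
by rewrite mulrDr !(mulrCA (a x)) lerD// ler_wpM2l ?modulus_ge0// wnorm_ub.
Qed.

Lemma wnormZ a f (s : K) : C0_set a f ->
  wnorm a (s *: f) <= modulus s * wnorm a f.
Proof.
move=> fa; have := wnorm_lin s 0 fa fa.
by rewrite scale0r addr0 modulus0 mul0r addr0.
Qed.

End WeightedFunctions.

Section WeightedBalls.
Context (R : realType) (k : scalar_kind) (Y : topologicalType).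
Local Notation K := (scalarField R k).
Context (S : lsubspace (Y -> K^o)) (a : weight R Y) (r : R).
Hypothesis Sa : S `<=` C0_set a.
Hypothesis r0 : 0 < r.

Definition sub_wball : set (lsubspace_of S) :=
  [set f | wnorm a (lsubspace_val f) < r].

Lemma sub_wball_aconvex : absolutely_convex sub_wball.
Proof.
move=> s t f g st fr gr.
have fa := Sa (lsubspace_of_set f); have ga := Sa (lsubspace_of_set g).
rewrite /sub_wball /= (le_lt_trans (wnorm_lin s t fa ga))//.
pose m := Num.max (wnorm a (lsubspace_val f)) (wnorm a (lsubspace_val g)).
have mr : m < r by rewrite gt_max; apply/andP.
have m0 : 0 <= m by rewrite le_max wnorm_ge0.
apply: le_lt_trans mr; apply: (@le_trans _ _ (modulus s * m + modulus t * m)).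
  by rewrite lerD// ler_wpM2l ?modulus_ge0// le_max lexx ?orbT.
rewrite -mulrDl ler_piMl// -(le_of_real k) of_realD of_real1.
by rewrite -!normr_modulus.
Qed.

Lemma sub_wball_absorbing : absorbing sub_wball.
Proof.
move=> f; have fa := Sa (lsubspace_of_set f).
pose c := wnorm a (lsubspace_val f) / r + 1.
have c0 : 0 < c by rewrite ltr_wpDl// divr_ge0 ?wnorm_ge0// ltW.
exists (of_real k c); first by rewrite -(of_real0 R k) lt_of_real.
move=> t + _ ->; rewrite normr_modulus le_of_real => ct.
have mt0 : 0 < modulus t by exact: lt_le_trans ct.
have t0 : t != 0 by rewrite -modulus_gt0.
exists (t^-1 *: f); last by rewrite scalerA divff// scale1r.
rewrite /sub_wball /= (le_lt_trans (wnormZ _ fa))// modulusV mulrC.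
rewrite ltr_pdivrMr// mulrC -ltr_pdivrMr//.
by rewrite (lt_le_trans _ ct)// ltrDl.
Qed.

End WeightedBalls.

Lemma sub_wball_scale (R : realType) (k : scalar_kind) (Y : topologicalType)
    (S : lsubspace (Y -> (scalarField R k)^o)) (a : weight R Y) (r : R)
    (t : scalarField R k) : S `<=` C0_set a -> 0 < t ->
  forall f : lsubspace_of S, sub_wball a (r / modulus t) f ->
    sub_wball a r (t *: f).
Proof.
move=> Sa t0 f; rewrite /sub_wball /= => fr.
have mt0 : 0 < modulus t by rewrite modulus_gt0 gt_eqF.
rewrite (le_lt_trans (wnormZ t (Sa _ (lsubspace_of_set f))))//.
by rewrite mulrC -ltr_pdivlMr.
Qed.

Section Banach.
Context (R : realType) (k : scalar_kind) (Y : topologicalType) (a : weight R Y).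
Local Notation K := (scalarField R k).

Definition C0_lsubspace : lsubspace (Y -> K^o) :=
  LSubspace (C0_set0 k a) (@C0_setP R k Y a).

Definition C0 := lsubspace_of C0_lsubspace.

HB.instance Definition _ := GRing.Lmodule.on C0.

Definition C0_norm (f : C0) : R := wnorm a (lsubspace_val f).

Definition C0_base : set_system C0 :=
  [set [set f | C0_norm f < r] | r in [set r | 0 < r]].

Lemma C0_base_neq0 : exists U, C0_base U.
Proof. by exists [set f | C0_norm f < 1], 1 => //=. Qed.

Lemma C0_base_setI U V : C0_base U -> C0_base V ->
  exists2 W, C0_base W & W `<=` U `&` V.
Proof.
move=> [r /= r0 <-] [s /= s0 <-]; exists [set f | C0_norm f < Num.min r s].
  by exists (Num.min r s) => //=; rewrite lt_min r0 s0.
by move=> f /=; rewrite lt_min => /andP[fr fs]; split.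
Qed.

Lemma C0_base_aconvex U : C0_base U -> absolutely_convex U.
Proof. by move=> [r /= r0 <-]; exact: sub_wball_aconvex. Qed.

Lemma C0_base_absorbing U : C0_base U -> absorbing U.
Proof. by move=> [r /= r0 <-]; exact: sub_wball_absorbing. Qed.

Lemma C0_base_scale U (t : K) : 0 < t -> C0_base U ->
  exists2 V, C0_base V & forall f, V f -> U (t *: f).
Proof.
move=> t0 [r /= r0 <-]; exists [set f | C0_norm f < r / modulus t].
  by exists (r / modulus t) => //=; rewrite divr_gt0// modulus_gt0 gt_eqF.
by move=> f; exact: sub_wball_scale.
Qed.

HB.instance Definition _ := Lmodule_isLocallyConvex.Build K C0
  C0_base_neq0 C0_base_setI C0_base_aconvex C0_base_absorbing C0_base_scale.

Lemma C0_nbhs0P (A : set C0) : nbhs 0 A <->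
  exists2 r : R, 0 < r & [set f | C0_norm f < r] `<=` A.
Proof.
split=> [[_ [r /= r0 <-] rA]|[r r0 rA]].
  by exists r => // f /rA; rewrite add0r.
by exists [set f | C0_norm f < r]; [exists r|move=> f /rA; rewrite add0r].
Qed.

End Banach.
Arguments C0 {R} k {Y} a.
Arguments C0_norm {R} k {Y} a.

Section Frechet.
Context (R : realType) (k : scalar_kind) (Y : topologicalType).
Context (A : increasing_weights R Y).
Local Notation K := (scalarField R k).

Definition CA0_set : set (Y -> K^o) := \bigcap_n C0_set (A n).

Lemma CA0_set0 : CA0_set 0.
Proof. by move=> n _; exact: C0_set0. Qed.

Lemma CA0_setP (s : K) f g : CA0_set f -> CA0_set g -> CA0_set (s *: f + g).
Proof. by move=> fA gA n _; apply: C0_setP; [exact: fA|exact: gA]. Qed.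

Definition CA0_lsubspace : lsubspace (Y -> K^o) := LSubspace CA0_set0 CA0_setP.

Definition CA0 := lsubspace_of CA0_lsubspace.

HB.instance Definition _ := GRing.Lmodule.on CA0.

Definition CA0_norm (n : nat) (f : CA0) : R := wnorm (A n) (lsubspace_val f).

Definition CA0_base : set_system CA0 := [set [set f | CA0_norm nr.1 f < nr.2] |
  nr in [set nr : nat * R | 0 < nr.2]].

Lemma CA0_sub n : CA0_lsubspace `<=` C0_set (A n).
Proof. by move=> f; exact. Qed.

Lemma CA0_norm_homo m n f : (m <= n)%N -> CA0_norm m f <= CA0_norm n f.
Proof.
move=> mn; have fn := @CA0_sub n _ (lsubspace_of_set f).
apply: wnorm_le => [|x]; first exact: wnorm_ge0.
apply: le_trans (wnorm_ub x fn).
by rewrite ler_wpM2r ?modulus_ge0// iweight_homo.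
Qed.

Lemma CA0_base_neq0 : exists U, CA0_base U.
Proof. by exists [set f | CA0_norm 0 f < 1], (0%N, 1) => //=. Qed.

Lemma CA0_base_setI U V : CA0_base U -> CA0_base V ->
  exists2 W, CA0_base W & W `<=` U `&` V.
Proof.
move=> [[m r] /= r0 <-] [[n s] /= s0 <-].
exists [set f | CA0_norm (maxn m n) f < Num.min r s].
  by exists (maxn m n, Num.min r s) => //=; rewrite lt_min r0 s0.
move=> f /=; rewrite lt_min => /andP[fr fs].
by split; [apply: le_lt_trans fr|apply: le_lt_trans fs]; apply: CA0_norm_homo;
  rewrite ?leq_maxl ?leq_maxr.
Qed.

Lemma CA0_base_aconvex U : CA0_base U -> absolutely_convex U.
Proof.
by move=> [[n r] /= r0 <-]; apply: sub_wball_aconvex; exact: CA0_sub.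
Qed.

Lemma CA0_base_absorbing U : CA0_base U -> absorbing U.
Proof.
by move=> [[n r] /= r0 <-]; apply: sub_wball_absorbing => //; exact: CA0_sub.
Qed.

Lemma CA0_base_scale U (t : K) : 0 < t -> CA0_base U ->
  exists2 V, CA0_base V & forall f, V f -> U (t *: f).
Proof.
move=> t0 [[n r] /= r0 <-]; exists [set f | CA0_norm n f < r / modulus t].
  by exists (n, r / modulus t) => //=; rewrite divr_gt0// modulus_gt0 gt_eqF.
by move=> f; apply: sub_wball_scale => //; exact: CA0_sub.
Qed.

HB.instance Definition _ := Lmodule_isLocallyConvex.Build K CA0
  CA0_base_neq0 CA0_base_setI CA0_base_aconvex CA0_base_absorbing
  CA0_base_scale.

Lemma CA0_nbhs0P (B : set CA0) : nbhs 0 B <->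
  exists n, exists2 r : R, 0 < r & [set f | CA0_norm n f < r] `<=` B.
Proof.
split=> [[_ [[n r] /= r0 <-] rB]|[n [r r0 rB]]].
  by exists n, r => // f /rB; rewrite add0r.
by exists [set f | CA0_norm n f < r]; [exists (n, r)|move=> f /rB; rewrite add0r].
Qed.

End Frechet.
Arguments CA0 {R} k {Y} A.
Arguments CA0_norm {R} k {Y} A.

(* [indC0] carries the finest locally convex topology making all inclusions
   C(a_n)_0(Y) -> ind_n C(a_n)_0(Y) continuous: an absolutely convex set is a
   neighbourhood of 0 iff its trace on every step is one. The universal property
   is [indC0_universal]. *)
Section InductiveLimit.
Context (R : realType) (k : scalar_kind) (Y : topologicalType).
Context (A : decreasing_weights R Y).
Local Notation K := (scalarField R k).

Definition indC0_set : set (Y -> K^o) := \bigcup_n C0_set (A n).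

Lemma indC0_set0 : indC0_set 0.
Proof. by exists 0%N => //; exact: C0_set0. Qed.

Lemma indC0_setP (s : K) f g :
  indC0_set f -> indC0_set g -> indC0_set (s *: f + g).
Proof.
move=> [m _ fm] [n _ gn]; exists (maxn m n) => //; apply: C0_setP.
- by apply: C0_set_le fm => x; rewrite dweight_homo// leq_maxl.
- by apply: C0_set_le gn => x; rewrite dweight_homo// leq_maxr.
Qed.

Definition indC0_lsubspace : lsubspace (Y -> K^o) :=
  LSubspace indC0_set0 indC0_setP.

Definition indC0 := lsubspace_of indC0_lsubspace.

HB.instance Definition _ := GRing.Lmodule.on indC0.

Lemma indC0_step_sub n : C0_lsubspace k (A n) `<=` indC0_lsubspace.
Proof. by move=> f fn; exists n. Qed.

Definition indC0_step n : {linear C0 k (A n) -> indC0} :=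
  inclusion (@indC0_step_sub n).

Lemma indC0_stepP (f : indC0) : exists n (g : C0 k (A n)), f = indC0_step n g.
Proof.
have [n _ fn] := lsubspace_of_set f.
by exists n, (@LSubspaceOf _ _ (C0_lsubspace k (A n)) _ (asboolT fn)); exact: val_inj.
Qed.

Definition indC0_base : set_system indC0 := [set U | absolutely_convex U /\
  forall n, nbhs (0 : C0 k (A n)) (indC0_step n @^-1` U)].

Lemma indC0_base_neq0 : exists U, indC0_base U.
Proof. by exists setT; split=> // n; exact: filterT. Qed.

Lemma indC0_base_setI U V : indC0_base U -> indC0_base V ->
  exists2 W, indC0_base W & W `<=` U `&` V.
Proof.
move=> [Uc U0] [Vc V0]; exists (U `&` V) => //; split.
  by move=> s t x y st [Ux Vx] [Uy Vy]; split; [exact: Uc|exact: Vc].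
by move=> n; apply: filterI; [exact: U0|exact: V0].
Qed.

Lemma indC0_base_aconvex U : indC0_base U -> absolutely_convex U.
Proof. by case. Qed.

Lemma indC0_base_absorbing U : indC0_base U -> absorbing U.
Proof.
move=> [_ U0] f; have [n [g ->]] := indC0_stepP f.
have [r r0 rU] := @nbhs0_absorbing K (C0 k (A n)) _ (U0 n) g.
exists r => // t rt _ ->; have [h Uh <-] := rU t rt g erefl.
by exists (indC0_step n h) => //; rewrite linearZ.
Qed.

Lemma indC0_base_scale U (t : K) : 0 < t -> indC0_base U ->
  exists2 V, indC0_base V & forall f, V f -> U (t *: f).
Proof.
move=> t0 [Uc U0]; exists [set f | U (t *: f)] => //; split.
  move=> a b f g ab Uf Ug; rewrite /= scalerDr !scalerA !(mulrC t) -!scalerA.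
  exact: Uc.
move=> n; apply: filterS (@nbhs0_scale K (C0 k (A n)) _ _ t0 (U0 n)) => f /=.
by rewrite linearZ.
Qed.

HB.instance Definition _ := Lmodule_isLocallyConvex.Build K indC0
  indC0_base_neq0 indC0_base_setI indC0_base_aconvex indC0_base_absorbing
  indC0_base_scale.

Lemma indC0_nbhs0P (B : set indC0) :
  nbhs 0 B <-> exists2 U, indC0_base U & U `<=` B.
Proof.
by split=> -[U BU UB]; exists U => // f /UB; rewrite add0r.
Qed.

Lemma indC0_step_continuous n : continuous (indC0_step n).
Proof.
by apply/linear_continuous_at0 => B /indC0_nbhs0P[U [_ U0]] UB;
  apply: filterS (U0 n) => f /UB.
Qed.

Lemma indC0_universal (F : tvsType K) (T : {linear indC0 -> F}) :
  continuous T <-> forall n, continuous (T \o indC0_step n).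
Proof.
split=> [cT n f|cT].
  by apply: continuous_comp; [exact: indC0_step_continuous|exact: cT].
apply/linear_continuous_at0 => B /nbhs0_aconvex[V [V0 Vc VB]].
apply/indC0_nbhs0P; exists (T @^-1` V); last by move=> f /VB.
split=> [s t f g st Vf Vg|n]; first by rewrite /= linearD !linearZ; exact: Vc.
by have /linear_continuous_at0 := cT n; apply.
Qed.

End InductiveLimit.
Arguments indC0 {R} k {Y} A.

(* [AC0] carries the initial topology with respect to the inclusions into the
   LB-spaces ind_n C(a_{N,n})_0(Y); see [AC0_initial]. *)
Section ProjectiveLimit.
Context (R : realType) (k : scalar_kind) (Y : topologicalType).
Context (A : double_weights R Y).
Local Notation K := (scalarField R k).

Definition AC0_set : set (Y -> K^o) := \bigcap_N indC0_set (A N).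

Lemma AC0_set0 : AC0_set 0.
Proof. by move=> N _; exact: indC0_set0. Qed.

Lemma AC0_setP (s : K) f g : AC0_set f -> AC0_set g -> AC0_set (s *: f + g).
Proof. by move=> fA gA N _; apply: indC0_setP; [exact: fA|exact: gA]. Qed.

Definition AC0_lsubspace : lsubspace (Y -> K^o) := LSubspace AC0_set0 AC0_setP.

Definition AC0 := lsubspace_of AC0_lsubspace.

HB.instance Definition _ := GRing.Lmodule.on AC0.

Lemma AC0_proj_sub N : AC0_lsubspace `<=` indC0_lsubspace k (A N).
Proof. by move=> f; exact. Qed.

Definition AC0_proj N : {linear AC0 -> indC0 k (A N)} :=
  inclusion (@AC0_proj_sub N).

Definition AC0_base : set_system AC0 := [set U |
  exists (m : nat) (V : forall N, set (indC0 k (A N))),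
    (forall N, nbhs 0 (V N) /\ absolutely_convex (V N)) /\
    U = \bigcap_(N in [set N | (N < m)%N]) (AC0_proj N @^-1` V N)].

Lemma AC0_base_neq0 : exists U, AC0_base U.
Proof.
exists setT, 0%N, (fun=> setT); split; first by split; [exact: filterT|].
by apply/seteqP; split.
Qed.

Lemma AC0_base_setI U V : AC0_base U -> AC0_base V ->
  exists2 W, AC0_base W & W `<=` U `&` V.
Proof.
move=> [m [U' [HU ->]]] [n [V' [HV ->]]].
pose W N := U' N `&` V' N.
exists (\bigcap_(N in [set N | (N < maxn m n)%N]) (AC0_proj N @^-1` W N)).
  exists (maxn m n), W; split=> // N.
  have [U0 Uc] := HU N; have [V0 Vc] := HV N; split; first exact: filterI.
  by move=> s t x y st [Ux Vx] [Uy Vy]; split; [exact: Uc|exact: Vc].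
move=> f fW; split=> N /= Nm.
  by have [|] := fW N => //=; rewrite (leq_trans Nm)// leq_maxl.
by have [|] := fW N => //=; rewrite (leq_trans Nm)// leq_maxr.
Qed.

Lemma AC0_base_aconvex U : AC0_base U -> absolutely_convex U.
Proof.
move=> [m [V [HV ->]]] s t f g st Uf Ug N Nm; rewrite /= linearD !linearZ.
by apply: (HV N).2 => //; [exact: Uf|exact: Ug].
Qed.

Lemma AC0_base_scale U (t : K) : 0 < t -> AC0_base U ->
  exists2 V, AC0_base V & forall f, V f -> U (t *: f).
Proof.
move=> t0 [m [V [HV ->]]].
pose W N := [set f | V N (t *: f)].
exists (\bigcap_(N in [set N | (N < m)%N]) (AC0_proj N @^-1` W N)).
  exists m, W; split=> // N; have [V0 Vc] := HV N.
  split; first exact: nbhs0_scale.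
  move=> a b f g ab Uf Ug; rewrite /W /= scalerDr !scalerA !(mulrC t) -!scalerA.
  exact: Vc.
by move=> f Wf N Nm; rewrite /= linearZ; exact: Wf.
Qed.

Lemma AC0_base_absorbing U : AC0_base U -> absorbing U.
Proof.
move=> [m [V [HV ->]]] f; elim: m => [|m [r r0 rV]].
  exists 1 => // t t1 _ ->; have t0 : t != 0.
    by rewrite -normr_gt0 (lt_le_trans _ t1).
  by exists (t^-1 *: f) => //; rewrite scalerA divff// scale1r.
have [s s0 sV] := nbhs0_absorbing (HV m).1 (AC0_proj m f).
exists (r + s); first exact: addr_gt0.
move=> t rst _ ->; have rt : r <= `|t| by rewrite (le_trans _ rst)// lerDl ltW.
have st : s <= `|t| by rewrite (le_trans _ rst)// lerDr ltW.
have t0 : t != 0 by rewrite -normr_gt0 (lt_le_trans r0).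
have [g Vg gf] := rV t rt f erefl; exists g => // N /= .
rewrite ltnS leq_eqVlt => /orP[/eqP ->|Nm]; last exact: Vg.
have [h Vh hf] := sV t st (AC0_proj m f) erefl.
have -> : AC0_proj m g = h => //.
by apply: (scalerI t0); rewrite -linearZ gf hf.
Qed.

HB.instance Definition _ := Lmodule_isLocallyConvex.Build K AC0
  AC0_base_neq0 AC0_base_setI AC0_base_aconvex AC0_base_absorbing
  AC0_base_scale.

Lemma AC0_nbhs0P (B : set AC0) : nbhs 0 B <-> exists2 U, AC0_base U & U `<=` B.
Proof.
by split=> -[U BU UB]; exists U => // f /UB; rewrite add0r.
Qed.

Lemma AC0_proj_continuous N : continuous (AC0_proj N).
Proof.
apply/linear_continuous_at0 => B /nbhs0_aconvex[V [V0 Vc VB]].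
apply/AC0_nbhs0P.
pose W M : set (indC0 k (A M)) := match pselect (N = M) with
  | left e => ecast M (set (indC0 k (A M))) e V
  | right _ => setT end.
have WN : W N = V by rewrite /W; case: pselect => // e; rewrite (eq_axiomK e).
exists (\bigcap_(M in [set M | (M < N.+1)%N]) (AC0_proj M @^-1` W M)).
  exists N.+1, W; split=> // M; rewrite /W; case: pselect => [e|_].
    by case: M / e.
  by split; [exact: filterT|].
by move=> f /(_ N (ltnSn N)); rewrite /= WN => /VB.
Qed.

Lemma AC0_initial (F : set_system AC0) (f : AC0) : Filter F ->
  F --> f <-> forall N, AC0_proj N @ F --> AC0_proj N f.
Proof.
move=> FF; split=> [Ff N|Ff].
  by move=> B /AC0_proj_continuous; exact: Ff.
move=> B [_ [m [V [HV ->]]]] VB.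
have {VB} : [set g | forall N, (N < m)%N -> V N (AC0_proj N (g - f))] `<=` B.
  move=> g Vg; rewrite -[g](subrK f) addrC; apply: VB => N Nm.
  exact: Vg.
move/filterS; apply; elim: m => [|m IH]; first exact: filterE.
have : F [set g | V m (AC0_proj m (g - f))].
  have /Ff : nbhs (AC0_proj m f) [set h | V m (h - AC0_proj m f)].
    apply/nbhs_shift0; apply: filterS (HV m).1 => h Vh.
    by rewrite /= addrAC subrr add0r.
  by move=> FV; apply: (@filterS _ F FF) FV => g; rewrite /= linearB.
move=> Fm; apply: filterS2 IH Fm => g Vg Vmg N; rewrite ltnS leq_eqVlt => /orP[/eqP ->//|].
exact: Vg.
Qed.

End ProjectiveLimit.
Arguments AC0 {R} k {Y} A.

(* Main.v *)
From HB Require Import structures.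
Require Import Defs.
From mathcomp Require Import all_boot all_order all_algebra.
From mathcomp Require Import complex.
From mathcomp Require Import all_classical all_reals all_analysis.
From mathcomp Require Import ring lra.

Set Implicit Arguments.
Unset Strict Implicit.
Unset Printing Implicit Defensive.

Import Order.TTheory GRing.Theory Num.Theory.
Import numFieldNormedType.Exports.

Local Open Scope classical_set_scope.
Local Open Scope ring_scope.

(** Write E for the space (AC)_0(X) and a_{N,n} for its weights.

   Both topological invariants are tested at single points. Evaluating (DN) on
   functions that peak at a point y, and (Omega) on the point evaluation at x,
   gives inequalities between the weights:
     a2_m <= C a2_l^t a2_n^(1-t)     and     a1_L^t a1_N^(1-t) <= D a1_M,
   where n is fixed once and for all, and (DN) may be used with the exponent t
   that (Omega) provides ([weights_DN], [weights_Omega]). Since a minimum is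
   bounded by geometric means, dividing them yields the condition
     min (a_{N,n}, a_{j,l} / S) <= a_{M,m}
   with n independent of N ([interpolation_condition],
   [tensor_inv_interpolation]).

   This condition makes E ultrabornological for any double sequence of weights
   ([interpolation_ultrabornological]). Let U be absolutely convex and absorb the
   Banach disks of E. Sets of the form
     { f in E | for all j, f in C(a_{j,nu j})_0 and a_{j,nu j} |f| <= c_j }
   are Banach disks ([banach_disk_weighted_disk]), so U absorbs them. Moreover E
   is solid: multiplication by a continuous function with values in [0, 1] maps E
   to itself ([AC0_split]), so every decomposition below can be a pointwise one.

   A gliding hump argument shows that for some N the set U absorbs the compactly
   supported functions with a_{N,n} |f| <= 1
   ([absorbs_compactly_supported_ball]). With M chosen for this N, let
   a_{M,m} |f| <= 1 for an arbitrary m. Up to an error in U the function f has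
   compact support ([compactly_supported_approx]). Cut it at the level
   1 / a_{N,n}: the lower part is absorbed by the choice of N, and where |f|
   exceeds that level the minimum above must be a_{j,l} / S, whence
   a_{j,l} |f| <= S for every j and the upper part lies in one weighted disk. So
   U absorbs, for every m, the functions in E with a_{M,m} |f| <= 1
   ([absorbs_ball]).

   Finally, if U contains d_m f for these functions, then it contains every f in E
   below a finite sum of the functions 2^-(m+1) d_m / a_{M,m}: by solidity f can
   be distributed over the summands ([envelope_sub]). The functions below such
   sums form a neighbourhood of the origin in ind_n C(a_{M,n})_0, so U is one in
   E. *)

(** * Real and complex scalars *)

Section Scalars.
Context (R : realType) (k : scalar_kind).
Local Notation K := (scalarField R k).
Implicit Types (r : R) (x y : K).

Lemma modulus_of_real r : modulus (of_real k r) = `|r|.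
Proof.
by case: k => //; rewrite /modulus normc_def /= expr0n /= addr0 sqrtr_sqr.
Qed.

Lemma modulus_ge0_of_real r : 0 <= r -> modulus (of_real k r) = r.
Proof. by move=> r0; rewrite modulus_of_real ger0_norm. Qed.

Lemma of_real_gt0 r : (0 < of_real k r) = (0 < r).
Proof. by rewrite -(of_real0 R k) lt_of_real. Qed.

Lemma of_real_eq0 r : (of_real k r == 0) = (r == 0).
Proof. by rewrite -(of_real0 R k) (inj_eq (@of_real_inj R k)). Qed.

Lemma of_realB r s : of_real k (r - s) = of_real k r - of_real k s.
Proof. by case: k => //=; rewrite rmorphB. Qed.

Lemma of_realV r : of_real k r^-1 = (of_real k r)^-1.
Proof.
have [->|r0] := eqVneq r 0; first by rewrite !(of_real0, invr0).
have kr0 : of_real k r != 0 by rewrite of_real_eq0.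
by apply: (mulfI kr0); rewrite -of_realM !divff// of_real1.
Qed.

Lemma modulus_le0 x : (modulus x <= 0) = (x == 0).
Proof. by rewrite le_eqVlt ltNge modulus_ge0 orbF modulus_eq0. Qed.

Lemma modulus_gt0_exists (e : K) : 0 < e -> exists2 r, 0 < r & e = of_real k r.
Proof.
move=> e0; exists (modulus e); first by rewrite modulus_gt0 gt_eqF.
by rewrite -normr_modulus gtr0_norm.
Qed.

(** The topology of the scalar field is given by a norm with values in the field
   itself; this restates continuity with real radii. *)
Lemma continuous_modulusP (T : topologicalType) (f : T -> K^o) (x : T) :
  {for x, continuous f} <->
  forall e : R, 0 < e -> \forall y \near x, modulus (f x - f y) < e.
Proof.
split=> [cf e e0|cf].
  have /cvgrPdist_lt/(_ (of_real k e)) := cf.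
  rewrite of_real_gt0 => /(_ e0); apply: filterS => y.
  by rewrite normr_modulus lt_of_real.
apply/cvgrPdist_lt => _ /modulus_gt0_exists[e e0 ->].
by apply: filterS (cf _ e0) => y; rewrite normr_modulus lt_of_real.
Qed.

Lemma of_real_continuous (T : topologicalType) (f : T -> R) :
  continuous f -> continuous (fun p : T => of_real k (f p) : K^o).
Proof.
move=> cf x; apply/continuous_modulusP => e e0.
have /cvgrPdist_lt/(_ e e0) := cf x; apply: filterS => y.
by rewrite -of_realB modulus_of_real.
Qed.

Lemma modulus_comp_continuous (T : topologicalType) (f : T -> K^o) :
  continuous f -> continuous (fun p : T => modulus (f p)).
Proof.
by move=> cf x; apply: (cvg_comp _ _ (cf x)); exact: modulus_continuous.
Qed.

End Scalars.

Lemma real_cauchy_seq (R : realType) (u : nat -> R) :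
  (forall e : R, 0 < e -> exists N, forall m n, (N <= m)%N -> (N <= n)%N ->
    `|u m - u n| < e) ->
  exists l, forall e : R, 0 < e -> exists N, forall n, (N <= n)%N -> `|u n - l| < e.
Proof.
move=> uC; have : cvgn u.
  apply/cauchy_cvgP/cauchy_exP => e e0; have [N uN] := uC _ e0.
  exists (u N); exists N => // n /= Nn; rewrite -ball_normE /=.
  exact: uN.
move=> cu; exists (limn u) => e e0.
have /cvgrPdist_lt/(_ e e0)[N _ uN] := cu.
by exists N => n /uN /=; rewrite distrC.
Qed.

(** Completeness of the scalar field; over the complex numbers it is applied to
   the real and imaginary parts. *)
Lemma scalar_cauchy_seq (R : realType) (k : scalar_kind)
    (u : nat -> scalarField R k) :
  (forall e : R, 0 < e -> exists N, forall m n, (N <= m)%N -> (N <= n)%N ->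
    modulus (u m - u n) < e) ->
  exists l, forall e : R, 0 < e -> exists N, forall n, (N <= n)%N ->
    modulus (u n - l) < e.
Proof.
case: k u => u uC; first exact: real_cauchy_seq.
have reC z : `|complex.Re z| <= complex.Re `|z : R[i]| /\
    `|complex.Im z| <= complex.Re `|z : R[i]|.
  rewrite normc_def /= -!sqrtr_sqr.
  by split; rewrite ler_sqrt ?addr_ge0 ?sqr_ge0// ?lerDl ?lerDr sqr_ge0.
have [|a ua] := @real_cauchy_seq R (fun n => complex.Re (u n)).
  move=> e /uC[N uN]; exists N => m n Nm Nn; apply: le_lt_trans (uN _ _ Nm Nn).
  by rewrite -raddfB; exact: (reC _).1.
have [|b ub] := @real_cauchy_seq R (fun n => complex.Im (u n)).
  move=> e /uC[N uN]; exists N => m n Nm Nn; apply: le_lt_trans (uN _ _ Nm Nn).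
  by rewrite -raddfB; exact: (reC _).2.
exists (a +i* b)%C => e e0.
have e20 : 0 < e / 2 by rewrite divr_gt0.
have [N aN] := ua _ e20; have [M bM] := ub _ e20.
exists (maxn N M) => n; rewrite geq_max => /andP[/aN an /bM bn].
rewrite /modulus [ltRHS]splitr.
apply: le_lt_trans (ltrD an bn); rewrite normc_def; case: (u n) => c d /=.
rewrite -[leRHS]ger0_norm ?addr_ge0// -sqrtr_sqr ler_sqrt ?sqr_ge0// (sqrrD `|c - a|).
by rewrite !real_normK ?num_real// -addrA lerD2l lerDr mulrn_wge0// mulr_ge0.
Qed.

Lemma powR_splitE (R : realType) (a t : R) : 0 <= a ->
  a = a `^ t * a `^ (1 - t).
Proof.
move=> a0; have tE : t + (1 - t) = 1 by ring.
by rewrite -powRD tE ?powRr1// oner_eq0.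
Qed.

(** * The topological invariants tested at points *)

Section Bumps.
Context (R : realType) (k : scalar_kind) (X : topologicalType).
Hypothesis X_hausdorff : hausdorff_space X.
Hypothesis X_locally_compact : locally_compact [set: X].
Context (A : increasing_weights R X).
Local Notation K := (scalarField R k).

Lemma exists_bump (x : X) (W : set X) : nbhs x W ->
  exists phi : X -> R, [/\ continuous phi, phi x = 1,
    forall y, 0 <= phi y <= 1, forall y, ~ W y -> phi y = 0 &
    exists2 F : set X, compact F & forall y, ~ F y -> phi y = 0].
Proof.
move=> xW; have [F xF [Fc Fcl]] : exists2 F, nbhs x F & compact F /\ closed F.
  have [F xF Fcc] := X_locally_compact (x := x) I; exists F => //.
  by move: xF; rewrite withinET.
pose B := ~` (W `&` F)^°.
have Bcl : closed B by apply: open_closedC; exact: open_interior.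
have nBx : ~ B x by apply: contrapT => /contrapT; apply; exact: filterI.
have sep := @locally_compact_completely_regular X R X_locally_compact
  X_hausdorff x B Bcl nBx.
pose u := @Urysohn X R [set x] B.
have uB y : B y -> u y = 1 by move=> By; apply: (Urysohn_sub1 sep); exists y.
have u01 y : 0 <= u y <= 1.
  have : `[0, 1]%classic (u y) by apply: (@Urysohn_range X R [set x] B); exists y.
  by rewrite /= in_itv.
exists (fun y => 1 - u y); split.
- by move=> y; apply: cvgB; [exact: cvg_cst|exact: Urysohn_continuous].
- by rewrite [u x](Urysohn_sub0 sep) ?subr0//; exists x.
- by move=> y; have /andP[] := u01 y; lra.
- by move=> y nWy; rewrite uB ?subrr// => /interior_subset[].
- by exists F => // y nFy; rewrite uB ?subrr// => /interior_subset[].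
Qed.

(** Testing with functions that peak at a point turns the topological invariants
   into inequalities between weights. The factor 2 leaves room for the variation
   of finitely many weights near the point. *)
Lemma CA0_peak (x : X) (L : nat) : exists f : CA0 k A,
  lsubspace_val f x = 1 /\
  forall n, (n <= L)%N -> CA0_norm k A n f <= 2 * A n x.
Proof.
have xW : nbhs x [set y | forall n, (n <= L)%N -> A n y <= 2 * A n x].
  have near1 n : nbhs x [set y | A n y <= 2 * A n x].
    have := @weight_continuous _ _ (A n) x => /cvgrPdist_lt/(_ _ (weight_gt0 (A n) x)).
    by apply: filterS => y /=; rewrite ltr_distlC => /andP[_]; lra.
  elim: L => [|L IH].
    by apply: filterS (near1 0%N) => y Ay n; rewrite leqn0 => /eqP ->.
  apply: filterS2 IH (near1 L.+1) => y IH AL n.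
  by rewrite leq_eqVlt => /orP[/eqP ->//|]; exact: IH.
have [phi [phic phix phi01 phiW [F Fc phiF]]] := exists_bump xW.
pose g y : K^o := of_real k (phi y).
have gA : CA0_set A g.
  move=> n _; split; first exact: of_real_continuous.
  move=> e e0; exists F => // y /phiF phiy.
  by rewrite /g phiy of_real0 modulus0 mulr0 normr0.
exists (@LSubspaceOf _ _ (CA0_lsubspace k A) _ (asboolT gA)) => /=; split.
  by rewrite /g phix of_real1.
move=> n nL; apply: wnorm_le => [|y /=].
  by rewrite mulr_ge0// ltW// weight_gt0.
have /andP[p0 p1] := phi01 y; rewrite /g modulus_ge0_of_real//.
have [Wy|/phiW ->] := pselect (forall n, (n <= L)%N -> A n y <= 2 * A n x).
  by rewrite (le_trans _ (Wy _ nL))// ler_piMr// ltW// weight_gt0.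
by rewrite mulr0 mulr_ge0// ltW// weight_gt0.
Qed.

Lemma CA0_norm_ub (n : nat) (f : CA0 k A) x :
  A n x * modulus (lsubspace_val f x) <= CA0_norm k A n f.
Proof. by apply: wnorm_ub; exact: (lsubspace_of_set f). Qed.

Lemma CA0_norm_ge0 (n : nat) (f : CA0 k A) : 0 <= CA0_norm k A n f.
Proof. by apply: wnorm_ge0; exact: (lsubspace_of_set f). Qed.

Lemma CA0_normZ (n : nat) (s : K) (f : CA0 k A) :
  CA0_norm k A n (s *: f) <= modulus s * CA0_norm k A n f.
Proof. exact: (wnormZ s (lsubspace_of_set f n I)). Qed.

Lemma weights_DN : condition_DN (E := CA0 k A) (CA0_norm k A) ->
  exists n, forall (m : nat) (t : R), (n <= m)%N -> 0 < t < 1 ->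
  exists (l : nat) (C : R), 0 < C /\
    forall x, A m x <= C * (A l x `^ t * A n x `^ (1 - t)).
Proof.
move=> [n DN]; exists n => m t nm t01; have [l [C [ml C0 DNC]]] := DN m t nm t01.
exists l, (C * 2); split => [|x]; first by rewrite mulr_gt0.
have [f [fx fL]] := CA0_peak x l.
have := CA0_norm_ub m f x; rewrite fx modulus1 mulr1 => /le_trans; apply.
rewrite (le_trans (DNC f))// -!mulrA ler_pM2l//.
have two0 : 0 <= 2 :> R by [].
have A0 i : 0 <= A i x by exact/ltW/weight_gt0.
have -> : 2 * (A l x `^ t * A n x `^ (1 - t)) =
    (2 * A l x) `^ t * (2 * A n x) `^ (1 - t).
  by rewrite !powRM// mulrACA -(powR_splitE t two0).
have /andP[t0 t1] := t01.
apply: ler_pM; rewrite ?powR_ge0//; apply: ge0_ler_powR;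
  rewrite ?nnegrE ?CA0_norm_ge0 ?mulr_ge0 ?subr_ge0 ?(ltW t0) ?(ltW t1)// fL//.
exact: leq_trans ml.
Qed.

Section Evaluation.
Context (x : X).

Definition evaluation (f : CA0 k A) : K^o := lsubspace_val f x.

Lemma evaluation_is_linear : linear evaluation.
Proof. by []. Qed.

HB.instance Definition _ :=
  GRing.isLinear.Build K (CA0 k A) K^o *:%R evaluation evaluation_is_linear.

Lemma evaluation_continuous : continuous (evaluation : CA0 k A -> K^o).
Proof.
apply/linear_continuous_at0 => U /nbhs_ballP[_ /= /modulus_gt0_exists[e e0 ->] eU].
apply/CA0_nbhs0P; exists 0%N, (A 0%N x * e); first by rewrite mulr_gt0// weight_gt0.
move=> f fe; apply: eU; rewrite -ball_normE /= sub0r normrN normr_modulus.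
rewrite lt_of_real -(ltr_pM2l (weight_gt0 (A 0%N) x)).
exact: le_lt_trans (CA0_norm_ub _ _ _) fe.
Qed.

Lemma dual_norm_evaluation_le (n : nat) :
  (dual_norm (CA0_norm k A) n evaluation <= (A n x)^-1%:E)%E.
Proof.
apply: ge_ereal_sup => _ [f /= f1 <-]; rewrite lee_fin.
rewrite -(ler_pM2l (weight_gt0 (A n) x)) divff ?gt_eqF ?weight_gt0//.
exact: le_trans (CA0_norm_ub _ _ _) f1.
Qed.

Lemma dual_norm_evaluation_ge (n : nat) :
  ((2 * A n x)^-1%:E <= dual_norm (CA0_norm k A) n evaluation)%E.
Proof.
have [f [fx fn]] := CA0_peak x n.
have c0 : 0 < 2 * A n x by rewrite mulr_gt0// weight_gt0.
apply: ereal_sup_ubound; exists (of_real k (2 * A n x)^-1 *: f) => /=.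
  rewrite (le_trans (CA0_normZ _ _ _))//.
  rewrite modulus_ge0_of_real ?invr_ge0 ?(ltW c0)// ler_pdivrMl// mulr1.
  exact: fn.
rewrite /evaluation [modulus _](_ : _ =
  modulus (of_real k (2 * A n x)^-1 * lsubspace_val f x))//.
by rewrite fx mulr1 modulus_ge0_of_real// invr_ge0 ltW.
Qed.

End Evaluation.

Lemma weights_Omega : condition_Omega (E := CA0 k A) (CA0_norm k A) ->
  forall N, exists2 M, (N <= M)%N & forall L, (M <= L)%N ->
  exists (D t : R), [/\ 0 < D, 0 < t < 1 &
    forall x, A L x `^ t * A N x `^ (1 - t) <= D * A M x].
Proof.
move=> Om N; have [M NM OM] := Om N; exists M => // L ML.
have [D [t [D0 t01 OD]]] := OM L ML; have /andP[t0 t1] := t01.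
exists (D * 2), t; split => // [|x]; first by rewrite mulr_gt0.
have := le_trans (dual_norm_evaluation_ge x M) (OD _ (@evaluation_continuous x)).
have dual_ge0 n : (0 <= dual_norm (CA0_norm k A) n (evaluation x))%E.
  apply: le_trans (dual_norm_evaluation_ge x n).
  by rewrite lee_fin invr_ge0 mulr_ge0// ltW// weight_gt0.
have pow_le n s : 0 <= s ->
    (dual_norm (CA0_norm k A) n (evaluation x) `^ s <= (A n x `^ s)^-1%:E)%E.
  move=> s0; rewrite -powRN -mulN1r powRrM powR_inv1 ?(ltW (weight_gt0 _ _))//.
  rewrite -poweR_EFin; apply: gt0_ler_poweR; rewrite ?in_itv /= ?leey ?andbT//.
    by rewrite lee_fin invr_ge0 ltW// weight_gt0.
  exact: dual_norm_evaluation_le.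
move=> /le_trans => /(_ ((D * (A L x `^ t)^-1 * (A N x `^ (1 - t))^-1)%:E)).
rewrite lee_fin => H.
have {H} : (2 * A M x)^-1 <= D * (A L x `^ t)^-1 * (A N x `^ (1 - t))^-1.
  apply: H; rewrite EFinM EFinM; apply: lee_pmul; rewrite ?mule_ge0 ?poweR_ge0
    ?lee_fin ?(ltW D0) ?pow_le ?subr_ge0 ?(ltW t1)//.
  by rewrite lee_pmul2l ?lte_fin// pow_le// ltW.
have L0 : 0 < A L x `^ t by rewrite powR_gt0// weight_gt0.
have N0 : 0 < A N x `^ (1 - t) by rewrite powR_gt0// weight_gt0.
have M0 := weight_gt0 (A M) x.
rewrite -mulrA -invfM ler_pdivlMr ?mulr_gt0// mulrC ler_pdivrMr ?mulr_gt0//.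
by rewrite mulrA.
Qed.

End Bumps.

(** * Interpolation between weights *)

Lemma min_le_geometric_mean (R : realType) (p q t : R) : 0 <= p -> 0 <= q ->
  0 < t < 1 -> Num.min p q <= q `^ t * p `^ (1 - t).
Proof.
move=> p0 q0 /andP[t0 t1]; set m := Num.min p q.
have m0 : 0 <= m by rewrite le_min p0.
rewrite [leLHS](powR_splitE t m0).
apply: ler_pM; rewrite ?powR_ge0//; apply: ge0_ler_powR;
  by rewrite ?nnegrE ?subr_ge0 ?(ltW t0) ?(ltW t1)// ge_min lexx ?orbT.
Qed.

(** The index n does not depend on N. Consequently the unit balls of
   C(a_{N,n})_0 decrease with N, which is what the gliding hump in
   [absorbs_compactly_supported_ball] rests on. *)
Definition interpolation_condition (R : realType) (Y : topologicalType)
    (A : double_weights R Y) :=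
  exists n : nat, forall N : nat, exists M : nat, forall m j : nat,
  exists (l : nat) (S : R), 0 < S /\
    forall x, Num.min (A N n x) (A j l x / S) <= A M m x.

(** With (Omega) for N, M and L >= j, and with (DN) for the exponent t of (Omega),
   the geometric mean of a_{N,n} and a_{L,l} / S with exponents 1 - t and t is at
   most D C a_{M,m} / S^t, which suggests the choice S^t = D C. *)
Lemma tensor_inv_interpolation (R : realType) (X1 X2 : topologicalType)
    (A1 : increasing_weights R X1) (A2 : increasing_weights R X2) :
  (forall N, exists2 M, (N <= M)%N & forall L, (M <= L)%N ->
    exists (D t : R), [/\ 0 < D, 0 < t < 1 &
      forall x, A1 L x `^ t * A1 N x `^ (1 - t) <= D * A1 M x]) ->
  (exists n, forall (m : nat) (t : R), (n <= m)%N -> 0 < t < 1 ->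
    exists (l : nat) (C : R), 0 < C /\
      forall x, A2 m x <= C * (A2 l x `^ t * A2 n x `^ (1 - t))) ->
  interpolation_condition (tensor_inv A1 A2).
Proof.
move=> Om [n DN]; exists n => N; have [M NM OM] := Om N; exists M => m j.
have [D [t [D0 t01 OD]]] := OM (maxn M j) (leq_maxl _ _).
have [l [C [C0 DC]]] := DN (maxn n m) t (leq_maxl _ _) t01.
have DC0 : 0 < D * C by rewrite mulr_gt0.
have /andP[t0 t1] := t01.
pose S := (D * C) `^ t^-1; have S0 : 0 < S by exact: powR_gt0.
have SE : S `^ t = D * C by rewrite -powRrM mulVf ?gt_eqF// powRr1// ltW.
exists l, S; split => // -[x y].
rewrite /= /tensor_inv_fun /=.
have W0 (X : topologicalType) (a : weight R X) z : 0 <= a z.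
  exact/ltW/weight_gt0.
have jL : A1 j x / A2 l y / S <=
    A1 (maxn M j) x / A2 l y / S.
  by rewrite !ler_pM2r ?invr_gt0 ?weight_gt0// iweight_homo// leq_maxr.
have mn : A1 M x / A2 (maxn n m) y <= A1 M x / A2 m y.
  rewrite ler_pM2l ?weight_gt0// lef_pV2 ?posrE ?weight_gt0//.
  by rewrite iweight_homo// leq_maxr.
apply: le_trans mn; apply: (@le_trans _ _ (Num.min (A1 N x / A2 n y)
    (A1 (maxn M j) x / A2 l y / S))).
  by rewrite le_min !ge_min lexx jL orbT.
apply: le_trans (min_le_geometric_mean _ _ t01) _;
  rewrite ?divr_ge0 ?(ltW S0)//.
have powV s r : s \in Num.nneg -> (s^-1) `^ r = (s `^ r)^-1.
  by rewrite nnegrE => s0; rewrite -(powR_inv1 s0) -powRrM mulN1r powRN.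
rewrite !powRM ?mulr_ge0 ?invr_ge0 ?(ltW S0)//.
rewrite !powV ?nnegrE ?(ltW S0)// SE.
have := OD x; have := DC y.
have := powR_gt0 t (weight_gt0 (A2 l) y).
have := powR_gt0 (1 - t) (weight_gt0 (A2 n) y).
have := weight_gt0 (A2 (maxn n m)) y.
move: (A2 l y `^ t) (A2 n y `^ (1 - t)) (A2 (maxn n m) y) => v u w w0 u0 v0 wuv.
rewrite ler_pdivlMr//.
move: (A1 _ x `^ t) (A1 N x `^ (1 - t)) => b a ab.
have -> : b / v / (D * C) * (a / u) * w = (b * a) / D * (w / (C * (v * u))).
  by field; rewrite !gt_eqF.
have ab0 : b * a / D <= A1 M x by rewrite ler_pdivrMr// [leRHS]mulrC.
apply: (@le_trans _ _ (A1 M x * (w / (C * (v * u))))).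
  by rewrite ler_wpM2r// divr_ge0 ?mulr_ge0// ltW.
by rewrite ler_piMr// ler_pdivrMr ?mulr_gt0// mul1r.
Qed.

(** * Absolutely convex sets and real scalars *)

Section Absorption.
Context (R : realType) (k : scalar_kind).
Local Notation K := (scalarField R k).
Context (E : lmodType K) (U : set E).

Lemma aconvex_scale (s : K) x : absolutely_convex U -> modulus s <= 1 -> U x ->
  U (s *: x).
Proof.
move=> Uc s1 Ux; have := Uc s 0 x x; rewrite scale0r addr0 normr0 addr0.
by apply=> //; rewrite normr_modulus -(of_real1 R k) le_of_real.
Qed.

Lemma aconvex_real_le (d r : R) x : absolutely_convex U -> 0 <= d -> d <= r ->
  U (of_real k r *: x) -> U (of_real k d *: x).
Proof.
move=> Uc d0 dr Urx; have [r0|r0] := eqVneq r 0.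
  have -> : d = r by apply/le_anti; rewrite dr r0 d0.
  exact: Urx.
have rE : 0 < r by rewrite lt0r r0 (le_trans d0).
have -> : of_real k d *: x = of_real k (d / r) *: (of_real k r *: x).
  by rewrite scalerA -of_realM divfK.
apply: aconvex_scale => //; rewrite modulus_ge0_of_real ?divr_ge0 ?(ltW rE)//.
by rewrite ler_pdivrMr// mul1r.
Qed.

Lemma aconvex_mid x y : absolutely_convex U ->
  U (of_real k 2 *: x) -> U (of_real k 2 *: y) -> U (x + y).
Proof.
move=> Uc Ux Uy; have h (z : E) : z = of_real k 2^-1 *: (of_real k 2 *: z).
  by rewrite scalerA -of_realM mulVf// of_real1 scale1r.
rewrite (h x) (h y); apply: Uc => //.
rewrite normr_modulus modulus_ge0_of_real ?invr_ge0// -of_realD -(of_real1 R k).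
by rewrite le_of_real; lra.
Qed.

Lemma absorbsP (B : set E) : absolutely_convex U ->
  absorbs U B <-> exists2 d : R, 0 < d & forall x, B x -> U (of_real k d *: x).
Proof.
move=> Uc; split=> [[_ /modulus_gt0_exists[r r0 ->] rU]|[d d0 dU]].
  exists r^-1 => [|x Bx]; first by rewrite invr_gt0.
  have rN0 : of_real k r != 0 by rewrite of_real_eq0 gt_eqF.
  have [|y Uy <-] := rU (of_real k r) _ x Bx.
    by rewrite normr_modulus modulus_ge0_of_real// ltW.
  by rewrite of_realV scalerA mulVf// scale1r.
exists (of_real k d^-1) => [|t]; first by rewrite of_real_gt0 invr_gt0.
rewrite normr_modulus le_of_real => dt x Bx.
have t0 : 0 < modulus t by rewrite (lt_le_trans _ dt)// invr_gt0.
have tN0 : t != 0 by rewrite -modulus_gt0.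
exists (t^-1 *: x); last by rewrite scalerA divff// scale1r.
have -> : t^-1 *: x = (t^-1 / of_real k d) *: (of_real k d *: x).
  by rewrite scalerA divfK// of_real_eq0 gt_eqF.
apply: aconvex_scale => //; last exact: dU.
rewrite modulusM !modulusV modulus_ge0_of_real ?(ltW d0)//.
by rewrite ler_pdivrMr// mul1r -[leRHS]invrK lef_pV2 ?posrE ?invr_gt0.
Qed.

End Absorption.

(** * Weighted Banach disks *)

(** This is the completeness of C(a)_0: the weight is bounded away from zero near
   each point, so a weighted uniform limit is a locally uniform one. *)
Lemma C0_set_uniform_limit (R : realType) (k : scalar_kind)
    (Y : topologicalType) (a : weight R Y) (h : Y -> (scalarField R k)^o) :
  (forall e : R, 0 < e -> exists2 f, C0_set a f &
    forall x, a x * modulus (f x - h x) <= e) -> C0_set a h.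
Proof.
move=> lim; split=> [x|e e0].
  apply/continuous_modulusP => e e0; have a0 := weight_gt0 a x.
  have [|f [cf _] fh] := lim (a x * (e / 6)); first by rewrite mulr_gt0// divr_gt0.
  have e3 : 0 < e / 3 by rewrite divr_gt0.
  have near_f := (continuous_modulusP f x).1 (cf x) _ e3.
  have near_a : \forall y \near x, a x / 2 < a y.
    have /cvgrPdist_lt/(_ (a x / 2)) := @weight_continuous _ _ a x.
    rewrite divr_gt0// => /(_ isT); apply: filterS => y.
    by rewrite ltr_distlC => /andP[+ _]; lra.
  apply: filterS2 near_f near_a => y fxy axy.
  have fhx : modulus (h x - f x) <= e / 6.
    by rewrite -modulusN opprB -(ler_pM2l a0) fh.
  have fhy : modulus (f y - h y) <= e / 3.
    rewrite -(ler_pM2l (weight_gt0 a y)); apply: le_trans (fh y) _.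
    have -> : a x * (e / 6) = a x / 2 * (e / 3) by field.
    by rewrite ler_pM2r// ltW.
  have -> : h x - h y = (h x - f x) + ((f x - f y) + (f y - h y)) by ring.
  have := le_modulusD (h x - f x) ((f x - f y) + (f y - h y)).
  have := le_modulusD (f x - f y) (f y - h y).
  lra.
have e20 : 0 < e / 2 by rewrite divr_gt0.
have [f [_ /(_ _ e20)[F Fc Ff]] fh] := lim _ e20; exists F => // x /Ff.
rewrite !ger0_norm ?wmod_ge0// => afx; rewrite [ltRHS]splitr.
apply: le_lt_trans (ltr_leD afx (fh x)); rewrite -mulrDr ler_pM2l ?weight_gt0//.
have {1}-> : h x = f x + - (f x - h x) by ring.
by rewrite (le_trans (le_modulusD _ _))// modulusN.
Qed.

Section Disks.
Context (R : realType) (k : scalar_kind) (Y : topologicalType).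
Context (A : double_weights R Y).
Local Notation K := (scalarField R k).
Local Notation E := (AC0 k A).
Local Notation fn f := (lsubspace_val f).
Implicit Types (f g h : E) (nu : nat -> nat) (c : nat -> R).

Lemma AC0_eq f g : (forall x, fn f x = fn g x) -> f = g.
Proof. by move=> fg; apply: val_inj; apply/funext. Qed.

Lemma AC0_linE (s t : K) f g :
  fn (s *: f + t *: g) = s *: (fn f) + t *: (fn g).
Proof. by []. Qed.

Lemma AC0_linEx (s t : K) f g x :
  fn (s *: f + t *: g) x = s * fn f x + t * fn g x.
Proof. by rewrite AC0_linE. Qed.

Lemma AC0_scaleEx (s : K) f x : fn (s *: f) x = s * fn f x.
Proof. by []. Qed.

Lemma AC0_subEx f g x : fn (f - g) x = fn f x - fn g x.
Proof. by []. Qed.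

Lemma C0_set_lin (a : weight R Y) (s t : K) (f g : Y -> K^o) :
  C0_set a f -> C0_set a g -> C0_set a (s *: f + t *: g).
Proof.
move=> fa ga; apply: C0_setP => //; rewrite -[t *: g]addr0.
by apply: C0_setP => //; exact: C0_set0.
Qed.

Lemma AC0_continuous f : continuous (fn f).
Proof. by have [n _ []] := lsubspace_of_set f 0%N I. Qed.

(** The requirement [C0_set (A j (nu j))], for the very index at which the bound is
   imposed, is what makes the disk complete: a limit of functions in E that merely
   satisfy the bounds could leave E. *)
Definition weighted_disk nu c : set E := [set f | forall j,
  C0_set (A j (nu j)) (fn f) /\ forall x, A j (nu j) x * modulus (fn f x) <= c j].

Lemma weighted_diskD nu c d (s t : K) f g :
  weighted_disk nu c f -> weighted_disk nu d g ->
  weighted_disk nu (fun j => modulus s * c j + modulus t * d j) (s *: f + t *: g).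
Proof.
move=> fc gd j; have [fa fj] := fc j; have [ga gj] := gd j; split.
  by rewrite AC0_linE; exact: C0_set_lin.
move=> x; rewrite AC0_linEx.
apply: le_trans (_ : A j (nu j) x * (modulus s * modulus (fn f x) +
    modulus t * modulus (fn g x)) <= _).
  by rewrite ler_pM2l ?weight_gt0// -!modulusM le_modulusD.
by rewrite mulrDr !(mulrCA (A _ _ x)) lerD// ler_wpM2l ?modulus_ge0.
Qed.

Lemma weighted_diskZ nu c (s : K) f : weighted_disk nu c f ->
  weighted_disk nu (fun j => modulus s * c j) (s *: f).
Proof.
move=> fc; have := weighted_diskD s 0 fc fc; rewrite scale0r addr0.
by congr (weighted_disk nu _ _); apply/funext => j; rewrite modulus0 mul0r addr0.
Qed.

Lemma weighted_diskW nu c d f : (forall j, c j <= d j) ->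
  weighted_disk nu c f -> weighted_disk nu d f.
Proof.
by move=> cd fc j; have [fa fj] := fc j; split=> // x; exact: le_trans (cd j).
Qed.

Lemma weighted_disk_scaleP nu c (r : R) f : 0 < r ->
  weighted_disk nu (fun j => r * c j) f <->
  weighted_disk nu c (of_real k r^-1 *: f).
Proof.
move=> r0; split=> fc.
  have := weighted_diskZ (of_real k r^-1) fc; congr (weighted_disk nu _ _).
  apply/funext => j; rewrite modulus_ge0_of_real ?invr_ge0 ?(ltW r0)//.
  by rewrite mulKf ?gt_eqF.
have := weighted_diskZ (of_real k r) fc.
rewrite scalerA -of_realM divff ?gt_eqF// of_real1 scale1r.
by rewrite modulus_ge0_of_real// ltW.
Qed.

Section BanachDisk.
Context (nu : nat -> nat) (c : nat -> R).
Hypothesis c0 : forall j, 0 < c j.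
Local Notation D := (weighted_disk nu c).

Lemma weighted_disk_aconvex : absolutely_convex D.
Proof.
move=> s t f g st Df Dg; apply: weighted_diskW (weighted_diskD s t Df Dg) => j.
rewrite -mulrDl ler_piMl ?(ltW (c0 _))// -(le_of_real k) of_realD of_real1.
by rewrite -!normr_modulus.
Qed.

Lemma weighted_disk0 (r : R) : 0 <= r ->
  weighted_disk nu (fun j => r * c j) 0.
Proof.
move=> r0 j; split; first exact: C0_set0.
by move=> x; rewrite modulus0 mulr0 mulr_ge0// ltW.
Qed.

Lemma weighted_disk_imageP (t : K) f : ( *:%R t @` D) f ->
  weighted_disk nu (fun j => modulus t * c j) f.
Proof. by move=> [g Dg <-]; exact: weighted_diskZ. Qed.

Lemma weighted_disk_image (r : R) f : 0 < r ->
  weighted_disk nu (fun j => r * c j) f -> ( *:%R (of_real k r) @` D) f.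
Proof.
move=> r0 /weighted_disk_scaleP => /(_ r0) Df; exists (of_real k r^-1 *: f) => //.
by rewrite scalerA -of_realM divff ?gt_eqF// of_real1 scale1r.
Qed.

Lemma weighted_disk_spanP f : disk_span D f <->
  exists2 r : R, 0 < r & weighted_disk nu (fun j => r * c j) f.
Proof.
split=> [[t /weighted_disk_imageP Dt]|[r r0 Df]]; last first.
  by exists (of_real k r); exact: weighted_disk_image.
exists (modulus t + 1); first by rewrite ltr_wpDl// modulus_ge0.
by apply: weighted_diskW Dt => j; rewrite ler_pM2r// lerDl.
Qed.

Lemma weighted_disk_span_lin (s t : K) f g : disk_span D f -> disk_span D g ->
  disk_span D (s *: f + t *: g).
Proof.
move=> /weighted_disk_spanP[r r0 fr] /weighted_disk_spanP[q q0 gq].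
apply/weighted_disk_spanP; exists (modulus s * r + modulus t * q + 1).
  by rewrite ltr_wpDl// addr_ge0// mulr_ge0 ?modulus_ge0// ltW.
apply: weighted_diskW (weighted_diskD s t fr gq) => j.
by rewrite !mulrA -mulrDl ler_pM2r// lerDl.
Qed.

Lemma weighted_disk_span_sub f g : disk_span D f -> disk_span D g ->
  disk_span D (f - g).
Proof.
by move=> Df Dg; have := weighted_disk_span_lin 1 (-1) Df Dg; rewrite scale1r scaleN1r.
Qed.

(** The gauge of the disk is the supremum of the weighted norms divided by the
   constants; these two lemmas give the two comparisons. *)
Lemma weighted_disk_gauge_lt f (e : R) : disk_span D f -> gauge D f < e ->
  weighted_disk nu (fun j => e * c j) f.
Proof.
move=> [t0 Dt0] fe; have [|_ [t Dt <-] te] := inf_lt _ fe.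
  by exists (modulus t0), t0.
apply: weighted_diskW (weighted_disk_imageP Dt) => j.
by rewrite ler_pM2r// ltW.
Qed.

Lemma weighted_disk_gauge_le f (r : R) : 0 < r ->
  weighted_disk nu (fun j => r * c j) f -> gauge D f <= r.
Proof.
move=> r0 Df; apply: ge_inf.
  by exists 0 => _ [t _ <-]; exact: modulus_ge0.
exists (of_real k r); last by rewrite modulus_ge0_of_real// ltW.
exact: weighted_disk_image.
Qed.

(** A neighbourhood of the origin in E only involves finitely many of the inductive
   limits, and in the N-th of them the disk is contained in a ball of the single
   step C(a_{N,nu N})_0. *)
Lemma weighted_disk_bounded : tvs_bounded D.
Proof.
move=> B /AC0_nbhs0P[_ [m [V [HV ->]]] VB].
suff [d d0 dV] : exists2 d : R, 0 < d & forall f, D f ->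
    forall N, (N < m)%N -> V N (AC0_proj k A N (of_real k d *: f)).
  have absV : absorbs (\bigcap_(N in [set N | (N < m)%N])
      (AC0_proj k A N @^-1` V N)) D.
    apply/absorbsP; last by exists d => // f /dV fV N; exact: fV.
    move=> s t f g st Vf Vg N Nm; rewrite /= linearD !linearZ.
    by apply: (HV N).2 => //; [exact: Vf|exact: Vg].
  have [r r0 rV] := absV; exists r => // t rt f Df.
  by have [g Vg <-] := rV t rt f Df; exists g => //; exact: VB.
have one N : exists2 d : R, 0 < d & forall f, D f ->
    V N (AC0_proj k A N (of_real k d *: f)).
  have [V0 Vc] := HV N; have /indC0_nbhs0P[W [_ W0] WV] := V0.
  have /C0_nbhs0P[r r0 rW] := W0 (nu N).
  exists (r / (2 * c N)); first by rewrite divr_gt0// mulr_gt0.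
  move=> f Df; have : weighted_disk nu (fun j => r / (2 * c N) * c j)
    (of_real k (r / (2 * c N)) *: f).
    have := weighted_diskZ (of_real k (r / (2 * c N))) Df.
    by rewrite modulus_ge0_of_real// divr_ge0 ?mulr_ge0 ?ltW.
  move: (_ *: f) => g /(_ N)[ga gN].
  pose g' := @LSubspaceOf _ _ (C0_lsubspace k (A N (nu N))) _ (asboolT ga).
  have -> : AC0_proj k A N g = indC0_step k (A N) (nu N) g' by exact: val_inj.
  apply/WV/rW => /=; apply: (@le_lt_trans _ _ (r / (2 * c N) * c N)).
    by apply: wnorm_le => //; rewrite !mulr_ge0 ?invr_ge0 ?mulr_ge0 ?ltW.
  have -> : r / (2 * c N) * c N = r / 2 by field; rewrite gt_eqF.
  by lra.
elim: m {VB} => [|m [d d0 dV]]; first by exists 1.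
have [r r0 rV] := one m; exists (Num.min d r); first by rewrite lt_min d0.
have dr0 : 0 <= Num.min d r by rewrite le_min !ltW.
move=> f Df N; rewrite ltnS leq_eqVlt => /orP[/eqP ->|Nm].
  rewrite linearZ; apply: (aconvex_real_le (r := r)) (HV m).2 dr0 _ _.
    by rewrite ge_min lexx orbT.
  by rewrite -linearZ; exact: rV.
rewrite linearZ; apply: (aconvex_real_le (r := d)) (HV N).2 dr0 _ _.
  by rewrite ge_min lexx.
by rewrite -linearZ; exact: dV.
Qed.

Lemma weighted_disk_gauge_eq0 f : disk_span D f -> gauge D f = 0 -> f = 0.
Proof.
move=> Df f0; apply: AC0_eq => x; apply/eqP; rewrite -(modulus_le0 (fn f x)).
rewrite leNgt; apply/negP => fx; have a0 := weight_gt0 (A 0%N (nu 0%N)) x.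
(* half of the lower bound for the gauge given by the value at x *)
pose e := A 0%N (nu 0%N) x * modulus (fn f x) / (2 * c 0%N).
have e0 : 0 < e by rewrite divr_gt0 ?mulr_gt0.
have := weighted_disk_gauge_lt Df; rewrite f0 => /(_ e e0 0%N)[_ /(_ x)].
have -> : e * c 0%N = A 0%N (nu 0%N) x * modulus (fn f x) / 2.
  by rewrite /e; field; rewrite gt_eqF.
have := mulr_gt0 a0 fx; lra.
Qed.

(** Cauchy sequences for the gauge converge pointwise, and the Cauchy estimates,
   being uniform in the point and in the index of the weight, pass to the limit. *)
Lemma weighted_disk_complete (u : nat -> E) : (forall n, disk_span D (u n)) ->
    (forall e : R, 0 < e -> exists N : nat, forall m n : nat,
      (N <= m)%N -> (N <= n)%N -> gauge D (u m - u n) < e) ->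
  exists2 f, disk_span D f & forall e : R, 0 < e -> exists N : nat,
    forall n : nat, (N <= n)%N -> gauge D (u n - f) < e.
Proof.
move=> Du uC.
have {}uC (e : R) : 0 < e -> exists N, forall m n, (N <= m)%N -> (N <= n)%N ->
    forall j x, A j (nu j) x * modulus (fn (u m) x - fn (u n) x) <= e * c j.
  move=> /uC[N uN]; exists N => m n Nm Nn j x.
  have Dmn := weighted_disk_span_sub (Du m) (Du n).
  by have [_ /(_ x)] := weighted_disk_gauge_lt Dmn (uN m n Nm Nn) j.
have /choice[h hu] x : exists l : K^o, forall e : R, 0 < e ->
    exists N, forall n, (N <= n)%N -> modulus (fn (u n) x - l) < e.
  apply: scalar_cauchy_seq => e e0; have a0 := weight_gt0 (A 0%N (nu 0%N)) x.
  pose r := A 0%N (nu 0%N) x * (e / 2) / c 0%N.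
  have r0 : 0 < r by rewrite !divr_gt0// mulr_gt0// divr_gt0.
  have [N uN] := uC _ r0; exists N => m n Nm Nn.
  have := uN m n Nm Nn 0%N x; rewrite divfK ?gt_eqF// ler_pM2l//.
  by move=> /le_lt_trans; apply; lra.
have {uC}hlim (e : R) : 0 < e -> exists N, forall n, (N <= n)%N ->
    forall j x, A j (nu j) x * modulus (fn (u n) x - h x) <= e * c j.
  move=> /uC[N uN]; exists N => n Nn j x; apply/ler_addgt0Pr => d d0.
  have a0 := weight_gt0 (A j (nu j)) x.
  have [M uM] := hu x (d / A j (nu j) x) (divr_gt0 d0 a0).
  have := uM (maxn M N) (leq_maxl _ _); rewrite ltr_pdivlMr// mulrC => /ltW.
  move=> /(lerD (uN n (maxn M N) Nn (leq_maxr _ _) j x)).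
  apply: le_trans; rewrite -mulrDr ler_pM2l//.
  rewrite [X in modulus X](_ : _ = (fn (u n) x - fn (u (maxn M N)) x) +
    (fn (u (maxn M N)) x - h x)); last by ring.
  exact: le_modulusD.
have hC0 j : C0_set (A j (nu j)) h.
  apply: C0_set_uniform_limit => e e0.
  have [N uN] := hlim (e / c j) (divr_gt0 e0 (c0 j)).
  exists (fn (u N)); last by move=> x; have := uN N (leqnn N) j x; rewrite divfK ?gt_eqF.
  by have /weighted_disk_spanP[r _ /(_ j)[]] := Du N.
have hAC0 : AC0_set A h by move=> j _; exists (nu j) => //.
pose f : E := @LSubspaceOf _ _ (AC0_lsubspace k A) h (asboolT hAC0).
have Dlim (e : R) : 0 < e -> exists N, forall n, (N <= n)%N ->
    weighted_disk nu (fun j => e * c j) (u n - f).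
  move=> /hlim[N uN]; exists N => n /uN {}uN j; split => [|x].
    have /weighted_disk_spanP[r _ /(_ j)[un _]] := Du n.
    have := AC0_linE 1 (-1) (u n) f; rewrite !scale1r !scaleN1r => ->.
    have := C0_set_lin 1 (-1) un (hC0 j).
    by rewrite scale1r scaleN1r.
  by rewrite AC0_subEx; exact: uN.
exists f.
  have [N /(_ N (leqnn N)) Df] := Dlim 1 ltr01.
  have {}Df : disk_span D (u N - f) by apply/weighted_disk_spanP; exists 1.
  have := weighted_disk_span_sub (Du N) Df.
  by rewrite opprB addrC subrK.
move=> e e0; have [N uN] := Dlim (e / 2) (divr_gt0 e0 (ltr0n R 2)).
exists N => n /uN /(weighted_disk_gauge_le (divr_gt0 e0 (ltr0n R 2))).
by move=> /le_lt_trans; apply; lra.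
Qed.

Lemma banach_disk_weighted_disk : banach_disk D.
Proof.
split.
- by exists 0; have := weighted_disk0 (@ler01 R); congr (weighted_disk nu _ _);
    apply/funext => j; rewrite mul1r.
- exact: weighted_disk_aconvex.
- exact: weighted_disk_bounded.
- exact: weighted_disk_gauge_eq0.
- exact: weighted_disk_complete.
Qed.

End BanachDisk.
End Disks.

(** * Solidity and compact supports *)

Section Ultrabornological.
Context (R : realType) (k : scalar_kind) (Y : topologicalType).
Context (A : double_weights R Y).
Local Notation K := (scalarField R k).
Local Notation E := (AC0 k A).
Local Notation fn f := (lsubspace_val f).
Implicit Types (f g h : E).

Lemma double_weight_homo n i j x : (i <= j)%N -> A i n x <= A j n x.
Proof.
by move=> ij; apply: (homo_leq (f := fun N => A N n x) lexx le_trans _ ij) => N;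
  exact: double_weight_le.
Qed.

Lemma C0_set_dominated (a : weight R Y) (f g : Y -> K^o) : continuous g ->
  (forall x, modulus (g x) <= modulus (f x)) -> C0_set a f -> C0_set a g.
Proof.
move=> cg gf [_ vf]; split=> // e /vf[F Fc Ff]; exists F => // x /Ff.
rewrite !ger0_norm ?wmod_ge0//; apply: le_lt_trans.
by rewrite ler_pM2l ?weight_gt0.
Qed.

Lemma AC0_split f (phi : Y -> R) : continuous phi ->
  (forall x, 0 <= phi x <= 1) ->
  exists g h, [/\ f = g + h,
    forall x, modulus (fn g x) = phi x * modulus (fn f x) &
    forall x, modulus (fn h x) = (1 - phi x) * modulus (fn f x)].
Proof.
move=> cphi phi01; pose u x : K^o := of_real k (phi x) * fn f x.
have mu x : modulus (u x) = phi x * modulus (fn f x).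
  by rewrite modulusM modulus_ge0_of_real//; have /andP[] := phi01 x.
have cu : continuous u.
  move=> x; apply: (@cvgM K Y (nbhs x) _ (fun p => of_real k (phi p)) (fn f)).
    exact: of_real_continuous.
  exact: AC0_continuous.
have uA : AC0_set A u.
  move=> N _; have [n _ fn] := lsubspace_of_set f N I; exists n => //.
  apply: C0_set_dominated fn => // x; rewrite mu ler_piMl ?modulus_ge0//.
  by have /andP[] := phi01 x.
pose g : E := @LSubspaceOf _ _ (AC0_lsubspace k A) u (asboolT uA).
exists g, (f - g); split => // [|x]; first by rewrite addrC subrK.
have -> : fn (f - g) x = of_real k (1 - phi x) * fn f x.
  by rewrite AC0_subEx of_realB of_real1 mulrBl mul1r.
rewrite modulusM modulus_ge0_of_real// subr_ge0.
by have /andP[] := phi01 x.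
Qed.

(** Splitting off the part of a function below a positive continuous level.
   Solidity of the space keeps both parts in it, and the remainder is supported
   where the function exceeds the level. *)
Lemma AC0_truncate f (w : Y -> R) : continuous w -> (forall x, 0 < w x) ->
  exists g h, [/\ f = g + h,
    forall x, modulus (fn g x) <= w x,
    forall x, modulus (fn g x) <= modulus (fn f x),
    forall x, modulus (fn h x) <= modulus (fn f x) &
    forall x, modulus (fn f x) <= w x -> fn h x = 0].
Proof.
move=> cw w0; pose M x := Num.max (w x) (modulus (fn f x)).
have wM x : w x <= M x by rewrite le_max lexx.
have M0 x : 0 < M x by exact: lt_le_trans (wM x).
have phi01 x : 0 <= w x / M x <= 1.
  by rewrite divr_ge0 ?(ltW (w0 _)) ?(ltW (M0 _))//= ler_pdivrMr// mul1r.
have cM : continuous M.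
  move=> x; apply: (@continuous_max R Y w (fun p => modulus (fn f p)) x).
    exact: cw.
  by apply: modulus_comp_continuous; exact: AC0_continuous.
have cphi : continuous (fun x => w x / M x).
  by move=> x; apply: cvgM; [exact: cw|apply: cvgV; [rewrite gt_eqF|exact: cM]].
have [g [h [fE gE hE]]] := AC0_split f cphi phi01.
exists g, h; split => // x.
- by rewrite gE mulrAC ler_pdivrMr// ler_pM2l// le_max lexx orbT.
- by rewrite gE ler_piMl ?modulus_ge0//; have /andP[] := phi01 x.
- rewrite hE ler_piMl ?modulus_ge0// gerBl.
  by have /andP[] := phi01 x.
- move=> fw; apply/eqP; rewrite -(modulus_eq0 (fn h x)) hE /M max_l//.
  by rewrite divff ?(gt_eqF (w0 x))// subrr mul0r.
Qed.

Definition compactly_supported f :=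
  exists2 F : set Y, compact F & forall x, ~ F x -> fn f x = 0.

Lemma compactly_supported_C0 (a : weight R Y) f : compactly_supported f ->
  C0_set a (fn f).
Proof.
move=> [F Fc Ff]; split; first exact: AC0_continuous.
by move=> e e0; exists F => // x /Ff ->; rewrite modulus0 mulr0 normr0.
Qed.

Lemma compactly_supported_le f g :
  (forall x, modulus (fn g x) <= modulus (fn f x)) ->
  compactly_supported f -> compactly_supported g.
Proof.
move=> gf [F Fc Ff]; exists F => // x /Ff fx; apply/eqP.
by rewrite -(modulus_le0 (fn g x)) (le_trans (gf x))// fx modulus0.
Qed.

Lemma C0_set_common_weight (f : Y -> K^o) (b : nat -> weight R Y) J :
  (forall j, C0_set (b j) f) ->
  exists2 a : weight R Y, C0_set a f & forall j, (j < J)%N -> forall x, b j x <= a x.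
Proof.
move=> fb; elim: J => [|J [a fa ba]]; first by exists (b 0%N).
have cab : continuous (fun x => a x + b J x).
  by move=> x; apply: cvgD; exact: weight_continuous.
have ab0 x : 0 < a x + b J x by rewrite addr_gt0 ?weight_gt0.
exists (Weight cab ab0).
  split => [|e e0]; first exact: fa.1.
  have e20 : 0 < e / 2 by rewrite divr_gt0.
  have [F Fc Ff] := fa.2 _ e20; have [G Gc Gf] := (fb J).2 _ e20.
  exists (F `|` G) => [|x /not_orP[/Ff + /Gf]]; first exact: compactU.
  rewrite !ger0_norm ?wmod_ge0//= => fx gx.
  by rewrite mulrDl [ltRHS]splitr ltrD.
move=> j; rewrite ltnS leq_eqVlt => /orP[/eqP ->|/ba bja] x /=.
  by rewrite lerDr ltW// weight_gt0.
by rewrite (le_trans (bja x))// lerDl ltW// weight_gt0.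
Qed.

(** * Sets absorbing the Banach disks *)

Context (U : set E).
Hypothesis U_aconvex : absolutely_convex U.
Hypothesis U_absorbs : forall B, banach_disk B -> absorbs U B.

Lemma absorbs_weighted_disk nu (c : nat -> R) : (forall j, 0 < c j) ->
  exists2 d : R, 0 < d & forall f, weighted_disk nu c f -> U (of_real k d *: f).
Proof.
by move=> c0; apply/absorbsP => //; exact/U_absorbs/banach_disk_weighted_disk.
Qed.

(** Compactly supported functions approximate every element of the space in the
   gauge of a suitable weighted disk: the constants of the disk grow faster than
   the weighted norms of the function, so that only finitely many weights need
   the truncation. Since U absorbs the disk, the error can be put into U. *)
Lemma compactly_supported_approx f : exists g r, [/\ f = g + r,
  compactly_supported g, forall x, modulus (fn g x) <= modulus (fn f x) &
  U (of_real k 2 *: r)].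
Proof.
have /choice[nu fnu] j : exists n, C0_set (A j n) (fn f).
  by have [n _ fn] := lsubspace_of_set f j I; exists n.
pose b j := wnorm (A j (nu j)) (fn f).
have b0 j : 0 <= b j by exact: wnorm_ge0.
pose c j := j.+1%:R * (b j + 1).
have c0 j : 0 < c j by rewrite mulr_gt0 ?ltr0n// ltr_wpDl.
have [d d0 dU] := absorbs_weighted_disk nu c0.
have d20 : 0 < d / 2 by rewrite divr_gt0.
pose J := Num.bound (d / 2)^-1.
have [a fa aJ] := C0_set_common_weight J fnu.
have cw : continuous (fun x => d / 2 / a x).
  move=> x; apply: cvgM; first exact: cvg_cst.
  by apply: cvgV; [rewrite gt_eqF// weight_gt0|exact: weight_continuous].
have w0 x : 0 < d / 2 / a x by rewrite divr_gt0// weight_gt0.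
have [r [g [fE rw rf gf g0]]] := AC0_truncate f cw w0.
exists g, r; split; [by rewrite addrC| |exact: gf|].
  have [F Fc Ff] := fa.2 _ d20; exists F => // x /Ff.
  rewrite ger0_norm ?wmod_ge0// => afx; apply: g0.
  by rewrite ler_pdivlMr ?weight_gt0// mulrC ltW.
have rd : weighted_disk nu (fun j => d / 2 * c j) r.
  move=> j; split; first by apply: C0_set_dominated (fnu j) => //; exact: AC0_continuous.
  move=> x; have [jJ|Jj] := ltnP j J.
    apply: (@le_trans _ _ (d / 2)).
      rewrite -[leRHS](divfK (_ : a x != 0)) ?gt_eqF ?weight_gt0// mulrC.
      apply: ler_pM; rewrite ?modulus_ge0 ?(ltW (weight_gt0 _ _))//.
      exact: aJ.
    rewrite ler_pMr// /c -[leLHS]mulr1 ler_pM// ?ler1n//.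
    by rewrite lerDr.
  apply: (@le_trans _ _ (b j)).
    apply: le_trans (wnorm_ub x (fnu j)).
    by rewrite ler_pM2l ?weight_gt0.
  rewrite /c mulrA; apply: (@le_trans _ _ (b j + 1)); first by rewrite lerDl.
  rewrite ler_peMl ?addr_ge0// mulrC -ler_pdivrMr// div1r.
  apply: le_trans (ltW (archi_boundP _)) _; first by rewrite invr_ge0 ltW.
  by rewrite ler_nat (leq_trans Jj).
have /weighted_disk_scaleP -/(_ d20) /dU := rd.
by rewrite scalerA -of_realM invf_div mulrCA divff ?gt_eqF// mulr1.
Qed.

(** Otherwise U fails to absorb each of these unit balls, and one compactly
   supported witness for each of them can be collected in a single weighted disk:
   the weights increase with the first index, so that the j-th weighted norm is
   at most 1 on all but the first j witnesses. *)
Lemma absorbs_compactly_supported_ball (n : nat) : exists N : nat,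
  exists2 d : R, 0 < d & forall f, compactly_supported f ->
    (forall x, A N n x * modulus (fn f x) <= 1) -> U (of_real k d *: f).
Proof.
apply: contrapT => notU.
have /choice[u uP] N : exists f, [/\ compactly_supported f,
    forall x, A N n x * modulus (fn f x) <= 1 & ~ U (of_real k N.+1%:R^-1 *: f)].
  apply: contrapT => nf; apply: notU; exists N, (N.+1%:R^-1).
    by rewrite invr_gt0 ltr0n.
  by move=> f fc f1; apply: contrapT => nUf; apply: nf; exists f.
pose c j : R := 1 + \sum_(i < j) wnorm (A j n) (fn (u i)).
have uC i j : C0_set (A j n) (fn (u i)).
  by apply: compactly_supported_C0; have [] := uP i.
have c1 j : 1 <= c j.
  by rewrite lerDl sumr_ge0// => i _; exact: wnorm_ge0.
have [d d0 dU] := absorbs_weighted_disk (fun=> n) (fun j => lt_le_trans ltr01 (c1 j)).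
pose i := Num.bound d^-1.
have [_ ui1] := uP i; apply; apply: (aconvex_real_le (r := d)) => //.
  rewrite -[leRHS]invrK lef_pV2 ?posrE ?invr_gt0 ?ltr0n//.
  apply: le_trans (ltW (archi_boundP _)) _; first by rewrite invr_ge0 ltW.
  by rewrite ler_nat.
apply: dU => j; split => // x; have [ij|ji] := ltnP i j.
  apply: le_trans (wnorm_ub x (uC i j)) _.
  rewrite /c (bigD1 (Ordinal ij))//= addrCA lerDl addr_ge0// sumr_ge0// => l _.
  exact: wnorm_ge0.
apply: le_trans (c1 j); apply: le_trans (ui1 x).
by rewrite ler_wpM2r ?modulus_ge0// double_weight_homo.
Qed.

(** For N as in [absorbs_compactly_supported_ball] and M from the condition, the
   function is cut at the level 1 / A N n. The upper part satisfies infinitely many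
   bounds at once, one for each j, so that a single weighted disk takes care of
   it. *)
Lemma absorbs_ball : interpolation_condition A ->
  exists M : nat, forall m : nat, exists2 d : R, 0 < d & forall f,
    (forall x, A M m x * modulus (fn f x) <= 1) -> U (of_real k d *: f).
Proof.
move=> [n interp]; have [N [d d0 dU]] := absorbs_compactly_supported_ball n.
have [M MP] := interp N; exists M => m.
have /choice[lS lSP] j : exists lS : nat * R, 0 < lS.2 /\
    forall x, Num.min (A N n x) (A j lS.1 x / lS.2) <= A M m x.
  by have [l [S lSP]] := MP m j; exists (l, S).
pose nu j := (lS j).1; pose c j := (lS j).2.
have c0 j : 0 < c j by exact: (lSP j).1.
have [e e0 eU] := absorbs_weighted_disk nu c0.
(* the factor 4 pays for splitting f into three summands by two bisections *)
pose r := Num.min 1 (Num.min d e) / 4.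
have min0 : 0 < Num.min 1 (Num.min d e) by rewrite !lt_min ltr01 d0.
have r0 : 0 < r by rewrite divr_gt0.
have r_le : [/\ 2 * (2 * r) <= 1, 2 * r <= d & 2 * (2 * r) <= e].
  have h t : Num.min 1 (Num.min d e) <= t -> 4 * r <= t.
    by rewrite /r mulrCA divff// mulr1.
  have := h 1; have := h d; have := h e.
  rewrite !ge_min !lexx !orbT /= => /(_ isT) re /(_ isT) rd /(_ isT) r1.
  by split; lra.
have {r_le}[r1 rd re] := r_le.
exists r => // f f1; have [g [s [fE gC gf Us]]] := compactly_supported_approx f.
have cw : continuous (fun x => (A N n x)^-1).
  move=> x; apply: cvgV; [by rewrite gt_eqF// weight_gt0|].
  exact: weight_continuous.
have w0 x : 0 < (A N n x)^-1 by rewrite invr_gt0 weight_gt0.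
have [g1 [h [gE g1w g1g hg h0]]] := AC0_truncate g cw w0.
have g1U : U (of_real k d *: g1).
  apply: dU => [|x]; first exact: compactly_supported_le gC.
  by rewrite -ler_pdivlMl ?weight_gt0// mulr1.
have hC : compactly_supported h by exact: compactly_supported_le gC.
have hU : U (of_real k e *: h).
  apply: eU => j; split => [|x]; first exact: compactly_supported_C0.
  have [/h0 ->|] := leP (modulus (fn g x)) (A N n x)^-1.
    by rewrite modulus0 mulr0 ltW.
  move=> gx; have Mf := f1 x.
  have g1x : A M m x * modulus (fn g x) <= 1.
    by apply: le_trans Mf; rewrite ler_pM2l ?weight_gt0.
  have gx0 : 0 < modulus (fn g x) by exact: lt_trans gx.
  (* where g exceeds the level 1 / A N n, the minimum is the other weight *)
  have MN : A M m x < A N n x.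
    rewrite -(ltr_pM2r gx0) (le_lt_trans g1x)//.
    by rewrite -ltr_pdivrMl ?weight_gt0// mulr1.
  have := (lSP j).2 x; rewrite ge_min leNgt MN /= ler_pdivrMr ?c0// => jx.
  apply: (@le_trans _ _ (A M m x * c j * modulus (fn g x))).
    apply: ler_pM => //; first exact/ltW/weight_gt0.
    exact: modulus_ge0.
  by rewrite mulrAC ler_piMl// ltW.
rewrite fE gE -addrA scalerDr; apply: aconvex_mid => //; rewrite scalerA -of_realM.
  by apply: aconvex_real_le g1U => //; rewrite mulr_ge0// ltW.
rewrite scalerDr; apply: aconvex_mid => //; rewrite scalerA -of_realM.
  by apply: aconvex_real_le hU => //; rewrite !mulr_ge0// ltW.
apply: aconvex_real_le Us => //; first by rewrite !mulr_ge0// ltW.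
by rewrite (le_trans r1)// ler1n.
Qed.

(** * From balls to a neighbourhood *)

Section Envelope.
Context (M : nat) (d : nat -> R).
Hypothesis d0 : forall m, 0 < d m.
Hypothesis dU : forall m f, (forall x, A M m x * modulus (fn f x) <= 1) ->
  U (of_real k (d m) *: f).

(** The sum of the functions [2 ^- (m + 1) * d (q + m) / A M (q + m)] over [m < p].
   The functions below such a sum for [q = 0] form a neighbourhood of the origin
   in the inductive limit. *)
Fixpoint envelope (p q : nat) (x : Y) : R :=
  if p is p'.+1 then (d q / A M q x + envelope p' q.+1 x) / 2 else 0.

Lemma envelope_ge0 p q x : 0 <= envelope p q x.
Proof.
elim: p q => //= p IH q; rewrite divr_ge0// addr_ge0//.
by rewrite divr_ge0// ltW// weight_gt0.
Qed.

Lemma level_continuous q : continuous (fun x => d q / A M q x).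
Proof.
move=> x; apply: cvgM; first exact: cvg_cst.
by apply: cvgV; [rewrite gt_eqF// weight_gt0|exact: weight_continuous].
Qed.

Lemma envelope_continuous p q : continuous (envelope p q).
Proof.
elim: p q => [|p IH] q x /=; first exact: cvg_cst.
by apply: cvgM; [apply: cvgD; [exact: level_continuous|exact: IH]|exact: cvg_cst].
Qed.

Lemma envelope_homo p p' q x : (p <= p')%N -> envelope p q x <= envelope p' q x.
Proof.
elim: p p' q => [|p IH] [|p'] q //= pp'; first exact: (envelope_ge0 p'.+1).
by rewrite ler_pM2r ?invr_gt0// lerD2l IH.
Qed.

Lemma envelope_term p q x :
  d (q + p)%N / A M (q + p)%N x / 2 ^+ p.+1 <= envelope p.+1 q x.
Proof.
elim: p q => [|p IH] q; first by rewrite /= addn0 addr0 expr1.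
rewrite exprS invfM mulrCA mulrC /= ler_pM2r ?invr_gt0//.
rewrite (le_trans (y := envelope p.+1 q.+1 x))//.
  by rewrite -addSnnS IH.
by rewrite lerDr divr_ge0 ?ltW ?weight_gt0.
Qed.

(** A function below the envelope is split along the summands into multiples of
   itself; by solidity the pieces stay in the space, where the balls that U
   absorbs can be used. *)
Lemma envelope_sub p q f :
  (forall x, modulus (fn f x) <= envelope p q x) -> U f.
Proof.
elim: p q f => [|p IH] q f fp.
  have -> : f = of_real k (d 0%N) *: 0.
    rewrite scaler0; apply: AC0_eq => x; apply/eqP.
    by rewrite -(modulus_le0 (fn f x)); exact: fp.
  by apply: dU => x; rewrite modulus0 mulr0.
pose w x := d q / A M q x; pose v x := envelope p q.+1 x.
have w0 x : 0 < w x by rewrite divr_gt0 ?weight_gt0.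
have v0 x : 0 <= v x by exact: envelope_ge0.
have wv0 x : 0 < w x + v x by rewrite ltr_wpDr.
have phi01 x : 0 <= w x / (w x + v x) <= 1.
  by rewrite divr_ge0 ?(ltW (w0 x)) ?(ltW (wv0 x))//= ler_pdivrMr// mul1r lerDl.
have cphi : continuous (fun x => w x / (w x + v x)).
  move=> x; apply: cvgM; first exact: level_continuous.
  apply: cvgV; first by rewrite gt_eqF.
  by apply: cvgD; [exact: level_continuous|exact: envelope_continuous].
have [g [h [fE /= gE hE]]] := AC0_split f cphi phi01.
have two : modulus (of_real k (2 : R)) = 2 :> R.
  by rewrite modulus_ge0_of_real.
have fwv x : modulus (fn f x) <= (w x + v x) / 2 by exact: fp.
rewrite fE; apply: aconvex_mid => //.
  have -> : of_real k 2 *: g = of_real k (d q) *: (of_real k (2 / d q) *: g).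
    by rewrite scalerA -of_realM mulrCA divff ?gt_eqF// mulr1.
  apply: dU => x; rewrite AC0_scaleEx modulusM gE.
  rewrite modulus_ge0_of_real ?divr_ge0 ?(ltW (d0 q))//.
  have := fwv x; rewrite ler_pdivlMr// => fwv2.
  have -> : A M q x * (2 / d q * (w x / (w x + v x) * modulus (fn f x))) =
      modulus (fn f x) * 2 / (w x + v x).
    have -> : d q = w x * A M q x by rewrite divfK// gt_eqF// weight_gt0.
    by field; rewrite !gt_eqF ?weight_gt0.
  by rewrite ler_pdivrMr// mul1r.
apply: (IH q.+1) => x; rewrite AC0_scaleEx modulusM two hE -/(v x).
have := fwv x; rewrite ler_pdivlMr// => fwv2.
have -> : 2 * ((1 - w x / (w x + v x)) * modulus (fn f x)) =
    v x * (modulus (fn f x) * 2 / (w x + v x)).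
  by field; rewrite gt_eqF.
by rewrite ler_piMr// ler_pdivrMr// mul1r.
Qed.

Lemma envelope_nbhs : indC0_base (k := k) (A := A M)
  [set f | exists p, forall x, modulus (lsubspace_val f x) <= envelope p 0 x].
Proof.
split=> [s t f g st [p fp] [p' gp']|m].
  exists (maxn p p') => x.
  have -> : lsubspace_val (s *: f + t *: g) x =
    s * lsubspace_val f x + t * lsubspace_val g x by [].
  rewrite (le_trans (le_modulusD _ _))// !modulusM.
  apply: (@le_trans _ _ ((modulus s + modulus t) * envelope (maxn p p') 0 x)).
    rewrite mulrDl lerD// ler_wpM2l ?modulus_ge0//.
      by rewrite (le_trans (fp x))// envelope_homo ?leq_maxl.
    by rewrite (le_trans (gp' x))// envelope_homo ?leq_maxr.
  rewrite ler_piMl ?envelope_ge0// -(le_of_real k) of_realD of_real1.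
  by rewrite -!normr_modulus.
apply/C0_nbhs0P; exists (d m / 2 ^+ m.+1); first by rewrite divr_gt0// exprn_gt0.
move=> f fm; exists m.+1 => x; apply: le_trans (envelope_term m 0 x).
rewrite add0n mulrAC ler_pdivlMr ?weight_gt0// mulrC.
apply: ltW; apply: le_lt_trans fm; apply: wnorm_ub.
exact: (lsubspace_of_set f).
Qed.

Lemma nbhs0_of_absorbed_balls : nbhs 0 U.
Proof.
pose V : set (indC0 k (A M)) :=
  [set f | exists p, forall x, modulus (lsubspace_val f x) <= envelope p 0 x].
have V0 : nbhs 0 V by apply/indC0_nbhs0P; exists V => //; exact: envelope_nbhs.
have V1 : nbhs 0 (AC0_proj k A M @^-1` V).
  by apply: (@AC0_proj_continuous R k Y A M 0); rewrite linear0.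
by apply: filterS V1 => f [p fp]; exact: envelope_sub fp.
Qed.

End Envelope.
End Ultrabornological.

Theorem interpolation_ultrabornological (R : realType) (k : scalar_kind)
    (Y : topologicalType) (A : double_weights R Y) :
  interpolation_condition A -> ultrabornological (AC0 k A).
Proof.
move=> interp U Uc Uabs; have [M MU] := absorbs_ball Uc Uabs interp.
have /choice[d dU] m : exists d : R, 0 < d /\ forall f : AC0 k A,
    (forall x, A M m x * modulus (lsubspace_val f x) <= 1) ->
    U (of_real k d *: f).
  by have [d d0 dU] := MU m; exists d.
apply: (nbhs0_of_absorbed_balls Uc (M := M) (d := d)) => m; first exact: (dU m).1.
exact: (dU m).2.
Qed.

Theorem theorem8 (R : realType) (k : scalar_kind) (X1 X2 : topologicalType)
    (A1 : increasing_weights R X1) (A2 : increasing_weights R X2)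
    (X1_hausdorff : hausdorff_space X1)
    (X1_locally_compact : locally_compact [set: X1])
    (X1_sigma_compact : sigma_compact X1)
    (X2_hausdorff : hausdorff_space X2)
    (X2_locally_compact : locally_compact [set: X2])
    (X2_sigma_compact : sigma_compact X2)
    (Omega_A1 : condition_Omega (E := CA0 k A1) (CA0_norm k A1))
    (DN_A2 : condition_DN (E := CA0 k A2) (CA0_norm k A2)) :
  ultrabornological (AC0 k (tensor_inv A1 A2)).
Proof.
apply/interpolation_ultrabornological/tensor_inv_interpolation.
- exact: weights_Omega Omega_A1.
- exact: weights_DN DN_A2.
Qed.
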